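(* Let $(M,J,g)$ be a metallic Riemannian manifold with $J^2=pJ+qI$, $p,q\in\mathbb R$, and let $\nabla$ be a linear connection on $M$. Define on the manifold $T^*M$ the $(1,1)$-tensor field $\tilde J_m:=\Phi^\nabla\circ\hat J_m\circ(\Phi^\nabla)^{-1}$ and the Riemannian metric $\tilde g:=((\Phi^\nabla)^{-1})^*(\hat g)$. Then $(T^*M,\tilde J_m,\tilde g)$ is a metallic Riemannian manifold (with the same $p,q$).
   Context: A metallic Riemannian manifold $(M,J,g)$ is a smooth manifold with a $(1,1)$-tensor field $J$ satisfying $J^2=pJ+qI$ for some real $p,q$ and a Riemannian metric $g$ with $g(JX,Y)=g(X,JY)$ for all vector fields $X,Y$. $\flat_g(X):=i_Xg$, $\sharp_g:=\flat_g^{-1}$, $(J^*\alpha)(X):=\alpha(JX)$. On $TM\oplus T^*M$: $\hat J_m(X+\alpha):=JX+J^*\alpha$ and $\hat g(X+\alpha,Y+\beta):=g(X,Y)+g(\sharp_g\alpha,\sharp_g\beta)$. Let $\pi:T^*M\to M$ be the projection. The connection $\nabla$ (through its dual connection on $T^*M$) gives the splitting $T(T^*M)=T^H(T^*M)\oplus T^V(T^*M)$ into horizontal and vertical subbundles. For $a\in T^*M$, $X\in T_{\pi(a)}M$ and $\alpha\in T^*_{\pi(a)}M$, set $\Phi^\nabla(X+\alpha):=X^H_a+\chi_a(\alpha)\in T_a(T^*M)$, where $X^H_a$ is the horizontal lift of $X$ to $a$ and $\chi_a:T^*_{\pi(a)}M\to T_a(T^*_{\pi(a)}M)\subset T_a(T^*M)$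 is the standard identification; for each $a$ this is a linear isomorphism $T_{\pi(a)}M\oplus T^*_{\pi(a)}M\to T_a(T^*M)$, and $\tilde J_m,\tilde g$ are defined by transporting $\hat J_m,\hat g$ at $\pi(a)$ to $T_a(T^*M)$ through it. *)

(* Defs.v *)
From HB Require Import structures.
From mathcomp Require Import all_boot all_order all_algebra.
From mathcomp Require Import all_classical all_reals all_analysis.

Set Implicit Arguments.
Unset Strict Implicit.
Unset Printing Implicit Defensive.

Import Order.TTheory GRing.Theory Num.Theory.
Import numFieldNormedType.Exports.

Local Open Scope classical_set_scope.
Local Open Scope ring_scope.

(* The element satisfying P; used for objects determined by a property that
   has exactly one solution on manifolds (and 0 when there is no solution). *)
Definition the (V : zmodType) (P : set V) : V := xget 0 P.

(* C^k and C^oo maps on an open set U of a (finite-dimensional) space. *)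
Fixpoint Ck_on (R : realType) (V W : normedModType R) (k : nat)
    (U : set V) (f : V -> W) : Prop :=
  if k is k'.+1 then
    (forall x, U x -> differentiable f x) /\
    (forall v, Ck_on k' U (fun x => 'D_v f x))
  else forall x, U x -> {for x, continuous f}.

Definition smooth_on (R : realType) (V W : normedModType R)
    (U : set V) (f : V -> W) : Prop :=
  forall k, Ck_on k U f.

(* A topological space with a family of charts modelled on R^n.  Outside
   chart_dom i (resp. chart_img i) the values of chart_map i (resp. chart_inv i)
   are irrelevant.  The axioms are in smooth_manifold. *)
Record charted (R : realType) (n : nat) := Charted {
  carrier :> topologicalType ;
  chart_index : Type ;
  chart_dom : chart_index -> set carrier ;
  chart_map : chart_index -> carrier -> 'rV[R]_n ;
  chart_inv : chart_index -> 'rV[R]_n -> carrier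
}.

Definition chart_img (R : realType) (n : nat) (M : charted R n)
    (i : chart_index M) : set 'rV[R]_n :=
  chart_map i @` chart_dom i.

Definition is_chart (R : realType) (n : nat) (M : charted R n)
    (i : chart_index M) : Prop :=
  [/\ open (chart_dom i),
      open (chart_img i),
      forall x, chart_dom i x -> chart_inv i (chart_map i x) = x,
      forall x, chart_dom i x -> {for x, continuous (chart_map i)} &
      forall u, chart_img i u -> {for u, continuous (chart_inv i)} ].

Definition smooth_manifold (R : realType) (n : nat) (M : charted R n) : Prop :=
  [/\ hausdorff_space M, @second_countable M,
      forall x : M, exists i, chart_dom i x,
      forall i : chart_index M, is_chart i &
      forall i j : chart_index M,
        smooth_on (chart_map i @` (chart_dom i `&` chart_dom j))
                  (chart_map j \o chart_inv i) ].

(* A tangent vector at x is the family of its coordinate vectors in all the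
   charts around x, related by the differentials of the transition maps. *)
Section tangent_space.
Context (R : realType) (n : nat) (M : charted R n) (x : M).

Definition tangent_pred : {pred chart_index M -> 'rV[R]_n} := fun v =>
  `[< (forall i, ~ chart_dom i x -> v i = 0) /\
      (forall i j, chart_dom i x -> chart_dom j x ->
        v j = 'd (chart_map j \o chart_inv i) (chart_map i x) (v i)) >].

Fact tangent_submod_closed : submod_closed tangent_pred.
Proof.
split=> [|a u v /asboolP[u0 uT] /asboolP[v0 vT]]; apply/asboolP.
  by split=> // i j _ _; rewrite linear0.
have uvE k : (a *: u + v) k = a *: u k + v k by [].
split=> [i xi|i j xi xj]; rewrite !uvE.
  by rewrite (u0 i xi) (v0 i xi) addr0; exact: scaler0.
by rewrite (uT i j xi xj) (vT i j xi xj) linearP.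
Qed.

HB.instance Definition _ :=
  GRing.isSubmodClosed.Build R _ tangent_pred tangent_submod_closed.

Record tangent := Tangent {
  tcoord :> chart_index M -> 'rV[R]_n ;
  _ : tcoord \in tangent_pred
}.

HB.instance Definition _ := [isSub for tcoord].
HB.instance Definition _ := [Choice of tangent by <:].
HB.instance Definition _ := [SubChoice_isSubLmodule of tangent by <:].

(* The tangent vector with coordinates u in the chart i. *)
Definition coord_vec (i : chart_index M) (u : 'rV[R]_n) : tangent :=
  the [set v : tangent | v i = u].

End tangent_space.

Section cotangent_space.
Context (R : realType) (n : nat) (M : charted R n) (x : M).

Definition cotangent_pred : {pred tangent x -> R^o} := fun f => `[< scalar f >].

Fact cotangent_submod_closed : submod_closed cotangent_pred.
Proof.
split=> [|a u v /asboolP lu /asboolP lv]; apply/asboolP => b X Y.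
  have E : 0 = b * 0 + 0 :> R by rewrite mulr0 addr0.
  exact: E.
have uvE Z : (a *: u + v) Z = a * u Z + v Z :> R by [].
by rewrite !uvE lu lv !mulrDr mulrCA addrACA.
Qed.

HB.instance Definition _ :=
  GRing.isSubmodClosed.Build R _ cotangent_pred cotangent_submod_closed.

Record cotangent := Cotangent {
  coform :> tangent x -> R^o ;
  _ : coform \in cotangent_pred
}.

HB.instance Definition _ := [isSub for coform].
HB.instance Definition _ := [Choice of cotangent by <:].
HB.instance Definition _ := [SubChoice_isSubLmodule of cotangent by <:].

(* Components of a covector in the chart i, and the covector with given
   components. *)
Definition cocoord (i : chart_index M) (a : cotangent) : 'rV[R]_n :=
  \row_k a (coord_vec x i (delta_mx 0 k)).

Definition coord_covec (i : chart_index M) (u : 'rV[R]_n) : cotangent :=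
  the [set a : cotangent | forall v, a v = \sum_k u 0 k * v i 0 k].

End cotangent_space.

Section cotangent_bundle.
Context (R : realType) (n : nat) (M : charted R n).

Record cotangent_bundle := Covector {
  foot : M ;
  covector : cotangent foot
}.

HB.instance Definition _ := gen_eqMixin cotangent_bundle.
HB.instance Definition _ := gen_choiceMixin cotangent_bundle.

Definition bundle_dom (i : chart_index M) : set cotangent_bundle :=
  [set a | chart_dom i (foot a)].

Definition bundle_map (i : chart_index M) (a : cotangent_bundle) :
    'rV[R]_(n + n) :=
  row_mx (chart_map i (foot a)) (cocoord i (covector a)).

Definition bundle_inv (i : chart_index M) (u : 'rV[R]_(n + n)) :
    cotangent_bundle :=
  Covector (coord_covec (chart_inv i (lsubmx u)) i (rsubmx u)).

Definition bundle_img (i : chart_index M) : set 'rV[R]_(n + n) :=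
  [set u | chart_img i (lsubmx u)].

(* The topology coinduced by the local parametrizations bundle_inv i. *)
Definition bundle_open : set_system cotangent_bundle :=
  [set O | forall i,
    open (bundle_inv i @^-1` O : set (subspace (bundle_img i)))].

Fact bundle_openT : bundle_open setT.
Proof. by move=> i; rewrite preimage_setT; exact: openT. Qed.

Fact bundle_openI : setI_closed bundle_open.
Proof. by move=> A B oA oB i; rewrite preimage_setI; exact: openI. Qed.

Fact bundle_open_bigU (I : Type) (f : I -> set cotangent_bundle) :
  (forall i, bundle_open (f i)) -> bundle_open (\bigcup_i f i).
Proof.
by move=> of_ i; rewrite preimage_bigcup; apply: bigcup_open => j _; exact: of_.
Qed.

HB.instance Definition _ := @isOpenTopological.Build cotangent_bundle
  bundle_open bundle_openT bundle_openI bundle_open_bigU.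

Definition cotangent_manifold : charted R (n + n) :=
  @Charted R (n + n) cotangent_bundle (chart_index M)
    bundle_dom bundle_map bundle_inv.

End cotangent_bundle.

Section tensor_calculus.
Context (R : realType) (n : nat) (M : charted R n).

Definition vector_field := forall x : M, tangent x.
Definition one_form := forall x : M, cotangent x.
Definition endo_field := forall x : M, tangent x -> tangent x.
Definition form_field := forall x : M, tangent x -> tangent x -> R.

Definition smooth_fun (f : M -> R) : Prop :=
  forall i, smooth_on (chart_img i) (f \o chart_inv i : 'rV[R]_n -> R^o).

Definition smooth_vf (X : vector_field) : Prop :=
  forall i, smooth_on (chart_img i) (fun u => X (chart_inv i u) i).

Definition smooth_form (a : one_form) : Prop :=
  forall i, smooth_on (chart_img i) (fun u => cocoord i (a (chart_inv i u))).

Definition frame (i : chart_index M) (k : 'I_n) : vector_field :=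
  fun x => coord_vec x i (delta_mx 0 k).

Definition tensor11 (J : endo_field) : Prop :=
  (forall x, linear (J x)) /\
  (forall i k, smooth_on (chart_img i)
     (fun u => J (chart_inv i u) (frame i k (chart_inv i u)) i)).

Definition riemannian_metric (g : form_field) : Prop :=
  [/\ forall x (Y : tangent x), scalar (fun X => g x X Y),
      forall x (X Y : tangent x), g x X Y = g x Y X,
      forall x (X : tangent x), X != 0 -> 0 < g x X X &
      forall i k l, smooth_on (chart_img i)
        (fun u => let x := chart_inv i u in
                  g x (frame i k x) (frame i l x) : R^o) ].

Definition metallic_riemannian (p q : R) (J : endo_field) (g : form_field) :
    Prop :=
  [/\ smooth_manifold M,
      tensor11 J,
      forall x (X : tangent x), J x (J x X) = p *: J x X + q *: X,
      riemannian_metric g &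
      forall x (X Y : tangent x), g x (J x X) Y = g x X (J x Y) ].

(* The derivative v(f) of a function f : M -> R along a tangent vector v. *)
Definition deriv_along (f : M -> R) (x : M) (v : tangent x) : R :=
  the [set d : R | forall i, chart_dom i x ->
    d = 'd (f \o chart_inv i : 'rV[R]_n -> R^o) (chart_map i x) (v i)].

(* Koszul's axioms; D X Y is nabla_X Y.  Only the values of D on smooth fields
   are constrained, and only these are used. *)
Definition linear_connection
    (D : vector_field -> vector_field -> vector_field) : Prop :=
  [/\ forall X Y, smooth_vf X -> smooth_vf Y -> smooth_vf (D X Y),
      forall f X X' Y, smooth_fun f ->
        smooth_vf X -> smooth_vf X' -> smooth_vf Y -> forall x,
        D (fun y => f y *: X y + X' y) Y x = f x *: D X Y x + D X' Y x,
      forall X Y Y', smooth_vf X -> smooth_vf Y -> smooth_vf Y' -> forall x,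
        D X (fun y => Y y + Y' y) x = D X Y x + D X Y' x &
      forall f X Y, smooth_fun f -> smooth_vf X -> smooth_vf Y -> forall x,
        D X (fun y => f y *: Y y) x =
          f x *: D X Y x + deriv_along f (X x) *: Y x ].

(* (nabla*_X a)(Y) = X(a(Y)) - a(nabla_X Y) *)
Definition dual_connection
    (D : vector_field -> vector_field -> vector_field)
    (X : vector_field) (a : one_form) : one_form :=
  fun x => the [set b : cotangent x | forall Y, smooth_vf Y ->
    b (Y x) = deriv_along (fun y => a y (Y y)) (X x) - a x (D X Y x)].

End tensor_calculus.

(* w is the image at y = F x of v under the tangent map of F : M -> N. *)
Definition pushforward (R : realType) (m n : nat)
    (M : charted R m) (N : charted R n) (F : M -> N)
    (x : M) (v : tangent x) (y : N) (w : tangent y) : Prop :=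
  F x = y /\
  forall i j, chart_dom i x -> chart_dom j y ->
    w j = 'd (chart_map j \o F \o chart_inv i) (chart_map i x) (v i).

Section bundle_isomorphism.
Context (R : realType) (n : nat) (M : charted R n).
Local Notation TsM := (cotangent_manifold M).

Definition bundle_proj (a : TsM) : M := foot a.

Definition section_of (s : one_form M) : M -> TsM := fun x => Covector (s x).

Section at_covector.
Context (D : vector_field M -> vector_field M -> vector_field M) (a : TsM).

(* T^H_a(T*M): velocities along smooth vector fields X of the 1-forms through
   a that are parallel in the direction X at bundle_proj a. *)
Definition horizontal : set (tangent a) :=
  [set w | exists X s, [/\ smooth_vf X, smooth_form s,
     section_of s (bundle_proj a) = a,
     dual_connection D X s (bundle_proj a) = 0 &
     pushforward (section_of s) (X (bundle_proj a)) w] ].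

Definition hlift (X : tangent (bundle_proj a)) : tangent a :=
  the [set w | horizontal w /\ pushforward bundle_proj w X].

(* chi_a(b): the velocity at t = 0 of the line t |-> a + t b in the fibre. *)
Definition vlift (b : cotangent (bundle_proj a)) : tangent a :=
  the [set w : tangent a | forall i, chart_dom i a ->
    w i = derive1 (fun t : R =>
            chart_map i (Covector (covector a + t *: b) : TsM)) 0].

Definition Phi (w : tangent (bundle_proj a) * cotangent (bundle_proj a)) :
    tangent a :=
  hlift w.1 + vlift w.2.

Definition Phi_inv (v : tangent a) :
    tangent (bundle_proj a) * cotangent (bundle_proj a) :=
  the [set w | Phi w = v].

End at_covector.

Definition flat (g : form_field M) (x : M) (X : tangent x) : cotangent x :=
  the [set b : cotangent x | forall Y, b Y = g x X Y].

Definition sharp (g : form_field M) (x : M) (b : cotangent x) : tangent x :=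
  the [set X | flat g X = b].

Definition pullback (J : endo_field M) (x : M) (b : cotangent x) :
    cotangent x :=
  the [set c : cotangent x | forall X, c X = b (J x X)].

Definition J_hat (J : endo_field M) (x : M) (w : tangent x * cotangent x) :
    tangent x * cotangent x :=
  (J x w.1, pullback J w.2).

Definition g_hat (g : form_field M) (x : M) (w z : tangent x * cotangent x) :
    R :=
  g x w.1 z.1 + g x (sharp g w.2) (sharp g z.2).

Definition J_tilde (D : vector_field M -> vector_field M -> vector_field M)
    (J : endo_field M) : endo_field TsM :=
  fun a v => Phi D (J_hat J (Phi_inv D v)).

Definition g_tilde (D : vector_field M -> vector_field M -> vector_field M)
    (g : form_field M) : form_field TsM :=
  fun a v w => g_hat g (Phi_inv D v) (Phi_inv D w).

End bundle_isomorphism.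

(* Main.v *)
From HB Require Import structures.
Require Import Defs.
From mathcomp Require Import all_boot all_order all_algebra.
From mathcomp Require Import all_classical all_reals all_analysis.
From mathcomp Require Import ring lra.

Set Implicit Arguments.
Unset Strict Implicit.
Unset Printing Implicit Defensive.

Import Order.TTheory GRing.Theory Num.Theory.
Import numFieldNormedType.Exports.

Local Open Scope classical_set_scope.
Local Open Scope ring_scope.

(** The point of the proof is that, in the chart that a chart of M induces on
    the cotangent bundle, the map Phi has the explicit form

      Phi (X + b) = (X, Gamma(u)(X, alpha) + b)      at the point (u, alpha),

    where Gamma(u)(X, alpha)_k = X^j alpha_l Gamma^l_jk(u) is the rate of
    change that makes a 1-form with value alpha parallel in the direction X.
    So Phi is a linear isomorphism in every fibre, and the algebraic claims
    (J^2 = pJ + q, symmetry and positivity of the metric, self-adjointness)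
    hold for the transported structures as soon as they hold for the fibrewise
    ones on TM + T*M, where they are short computations.  Since
    (X, w) |-> (X, w - Gamma(u)(X, alpha)) is an explicit inverse, the
    components of the transported tensors are rational expressions in those of
    J, of g and of the connection, with denominator det g; so they are smooth.

    What has to be built underneath is the following.

    A connection is given by its values on global smooth fields only, so the
    Christoffel symbols come from cutoff functions ([cutoff_exists]): an
    exp(-1/t)-type bump in a chart, extended by zero, which is smooth on M
    because a compact set in a Hausdorff space is closed.  Tensoriality in the
    first argument and the Leibniz rule in the second give
    D X Y = dY(X) + X^j Y^k Gamma_jk near every point
    ([christoffel_exists]).

    The dual connection is defined by testing against vector fields; in
    coordinates it is ds(X) - Gamma(X, s) ([dual_connE]).  A horizontal vector
    is therefore (X, Gamma(X, alpha)), and such a vector exists for every X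
    because a covector extends to a 1-form with any prescribed derivative
    ([hliftE]).  A vertical lift is the derivative of a curve that is affine in
    every induced chart ([vliftE]).  Both together give [PhiE].

    The cotangent bundle is a smooth manifold ([bundle_manifold]): its
    transition maps are built from those of M and their derivatives; points
    over distinct feet are separated in M and points over the same foot in one
    chart; a countable basis is made of products of basic sets of M with
    rational balls in the fibres.

    The differential calculus below ([Ck_on] is closed under the algebraic
    operations, composition and matrix inversion) is proved directly from the
    inductive definition: every rule expresses the derivative of the new
    function through the same operations applied to functions that are one
    degree less regular. *)

(** * Germs and differentials *)

Section germs.
Context (R : realType).
Implicit Types V W Z : normedModType R.

(** The expansion that defines the differential is asymptotic at x, hence
    insensitive to changes away from x; uniqueness of the linear part does the
    rest. *)
Lemma near_eq_diff V W (f g : V -> W) (x : V) :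
  {near x, f =1 g} -> differentiable f x ->
  differentiable g x /\ 'd g x = 'd f x :> (V -> W).
Proof.
move=> fg df.
have H : g \o shift x = cst (g x) + 'd f x +o_ 0 id.
  apply/eqaddoP => e e0; have fgx := nbhs_singleton fg.
  have /eqaddoP/(_ e e0) := diff_locally df.
  have : \forall h \near (0 : V), f (h + x) = g (h + x).
    have /= := (@near_shift _ _ 0 x (fun y => f y = g y)).
    by rewrite subr0 => <-.
  by apply: filterS2 => h; rewrite !fctE /= fgx => ->.
have dg : 'd g x = 'd f x :> (V -> W).
  by apply: diff_unique => //; exact: diff_continuous.
by split=> //; apply/diff_locallyP; rewrite dg; split => //;
  exact: diff_continuous.
Qed.

Lemma open_near_eq V W (U : set V) (f g : V -> W) (x : V) : open U ->
  {in U, f =1 g} -> U x -> {near x, f =1 g}.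
Proof.
move=> oU fg Ux; have : nbhs x U by exact: open_nbhs_nbhs.
by apply: filterS => y Uy; apply: fg; rewrite inE.
Qed.

Lemma diff_comp_at V W Z (f : V -> W) (g : W -> Z) (x v : V) :
  differentiable f x -> differentiable g (f x) ->
  'd (fun y => g (f y)) x v = 'd g (f x) ('d f x v).
Proof. by move=> df dg; have /(congr1 (@^~ v)) := diff_comp df dg. Qed.

(** The chain rule with the value f x replaced by a provably equal point:
    the base point occurs in the type of a differential, where it cannot be
    rewritten afterwards. *)
Lemma diff_comp_eq V W Z (f : V -> W) (g : W -> Z) (x v : V) (y : W) :
  f x = y -> differentiable f x -> differentiable g y ->
  differentiable (fun z => g (f z)) x /\
  'd (fun z => g (f z)) x v = 'd g y ('d f x v).
Proof.
move=> <- df dg; split; first exact: differentiable_comp.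
exact: diff_comp_at.
Qed.

Lemma rV_expand m (u : 'rV[R]_m) : u = \sum_j u 0 j *: delta_mx 0 j.
Proof.
apply/rowP => k; rewrite summxE (bigD1 k)//= !mxE !eqxx mulr1.
by rewrite big1 ?addr0// => j /negPf jk; rewrite !mxE eq_sym jk andbF mulr0.
Qed.

Lemma linear_rV_continuous m W (L : {linear 'rV[R]_m -> W}) : continuous L.
Proof.
have -> : (L : _ -> W) = (fun u => \sum_j u 0 j *: L (delta_mx 0 j)).
  apply/funext => u; rewrite {1}[u]rV_expand linear_sum.
  by apply: eq_bigr => j _; rewrite linearZ.
elim: (index_enum _) => [|j r IH] u.
  rewrite (_ : (fun _ => _) = cst 0); first exact: cst_continuous.
  by apply/funext => v; rewrite big_nil.
rewrite (_ : (fun _ => _) = fun v : 'rV[R]_m =>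
    v 0 j *: L (delta_mx 0 j) + \sum_(i <- r) v 0 i *: L (delta_mx 0 i)).
  2: by apply/funext => v; rewrite big_cons.
have ce : continuous_at u (fun v : 'rV[R]_m => v 0 j *: L 'e_j).
  by apply: continuousZr_tmp; exact: coord_continuous.
exact: continuousD ce (IH u).
Qed.

End germs.

(** * Calculus of maps of class C^k *)

Section Ck.
Context (R : realType).
Implicit Types V W Z : normedModType R.

Lemma eq_Ck V W k (U : set V) (f g : V -> W) : open U ->
  {in U, f =1 g} -> Ck_on k U f -> Ck_on k U g.
Proof.
move=> oU; elim: k f g => [|k IH] f g fg /=.
  move=> cf x Ux; suff : f @ x --> g x.
    by apply: cvg_trans; exact/near_eq_cvg/(open_near_eq oU fg Ux).
  by rewrite -fg ?inE//; exact: cf.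
move=> [df Df]; split=> [x Ux|v].
  by have [] := near_eq_diff (open_near_eq oU fg Ux) (df x Ux).
apply: IH (Df v) => x; rewrite inE => Ux.
exact/near_eq_derive/(open_near_eq oU fg Ux).
Qed.

Lemma sub_Ck V W k (U U' : set V) (f : V -> W) : U' `<=` U ->
  Ck_on k U f -> Ck_on k U' f.
Proof.
move=> UU'; elim: k f => [|k IH] f /=; first by move=> cf x /UU'; exact: cf.
by move=> [df Df]; split=> [x /UU'|v]; [exact: df|exact/IH].
Qed.

(** The neighbourhood U' may depend on x and on k: each clause of the
    definition is pointwise in x. *)
Lemma Ck_local V W k (U : set V) (f : V -> W) :
  (forall x, U x -> exists2 U', U' x & Ck_on k U' f) -> Ck_on k U f.
Proof.
elim: k f => [|k IH] f /= H; first by move=> x /H[U' /[swap]]; exact.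
split=> [x /H[U' U'x [df _]]|v]; first exact: df.
by apply: IH => x /H[U' U'x [_ Df]]; exists U'.
Qed.

Lemma Ck_pred V W k (U : set V) (f : V -> W) : Ck_on k.+1 U f -> Ck_on k U f.
Proof.
elim: k f => [|k IH] f /= [df Df].
  by move=> x /df; exact: differentiable_continuous.
by split=> // v; exact: IH.
Qed.

Lemma Ck_cst V W k (U : set V) (c : W) : Ck_on k U (fun _ : V => c).
Proof.
elim: k c => [|k IH] c /=; first by move=> x _; exact: cvg_cst.
split=> [x _|v]; first exact: differentiable_cst.
rewrite (_ : 'D_v _ = fun=> 0); first exact: IH.
by apply/funext => x; exact: derive_cst.
Qed.

(** A continuous linear map commutes with directional derivatives, so the
    induction needs no product rule. *)
Lemma Ck_lin_comp V W Z k (U : set V) (l : W -> Z) (f : V -> W) :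
  open U -> linear l -> continuous l -> Ck_on k U f ->
  Ck_on k U (fun x => l (f x)).
Proof.
move=> oU ll; pose lM := GRing.isLinear.Build _ _ _ _ _ ll.
pose L : {linear _ -> _} := HB.pack l lM; rewrite -[l]/(L : _ -> _) => cL.
 elim: k f => [|k IH] f /=.
  by move=> cf x /cf; move/continuous_comp; apply; exact: cL.
move=> [df Df]; have dL y : differentiable L y by exact: linear_differentiable.
have dLf x : U x -> differentiable (fun y => L (f y)) x.
  by move=> /df dfx; exact: differentiable_comp.
split=> // v; apply: eq_Ck (IH _ (Df v)) => // x; rewrite inE => Ux.
rewrite deriveE; last exact: df.
rewrite deriveE; last exact: dLf.
by rewrite (diff_comp_at v (df x Ux) (dL (f x))) diff_lin.
Qed.

Lemma Ck_lin V W k (U : set V) (L : {linear V -> W}) :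
  open U -> continuous L -> Ck_on k U L.
Proof.
move=> oU cL; case: k => [|k] /=; first by move=> x _; exact: cL.
split=> [x _|v]; first exact: linear_differentiable.
rewrite (_ : 'D_v _ = fun=> L v); first exact: Ck_cst.
by apply/funext => x; rewrite deriveE ?diff_lin//; exact: linear_differentiable.
Qed.

Lemma Ck_id V k (U : set V) : open U -> Ck_on k U (fun x : V => x).
Proof. move=> oU; have cid : continuous (idfun : {linear V -> V}) by move=> x.
exact: Ck_lin oU cid. Qed.

Lemma CkD V W k (U : set V) (f g : V -> W) : open U ->
  Ck_on k U f -> Ck_on k U g -> Ck_on k U (fun x => f x + g x).
Proof.
move=> oU; elim: k f g => [|k IH] f g /=.
  by move=> cf cg x Ux; apply: cvgD; [exact: cf|exact: cg].
move=> [df Df] [dg Dg]; split=> [x Ux|v].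
  by apply: differentiableD; [exact: df|exact: dg].
apply: eq_Ck (IH _ _ (Df v) (Dg v)) => // x; rewrite inE => Ux.
by rewrite -deriveD//; apply: diff_derivable; [exact: df|exact: dg].
Qed.

Lemma Ck_sum V W k (I : Type) (r : seq I) (P : pred I) (U : set V)
    (f : I -> V -> W) : open U -> (forall i, Ck_on k U (f i)) ->
  Ck_on k U (fun x => \sum_(i <- r | P i) f i x).
Proof.
move=> oU fU; elim: r => [|i r IH].
  by under eq_fun do rewrite big_nil; exact: Ck_cst.
under eq_fun do rewrite big_cons; case: (P i) => //; exact: CkD.
Qed.

Lemma CkM V k (U : set V) (f g : V -> R^o) : open U ->
  Ck_on k U f -> Ck_on k U g -> Ck_on k U (fun x => f x * g x : R^o).
Proof.
move=> oU; elim: k f g => [|k IH] f g.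
  by move=> cf cg x Ux; apply: cvgM; [exact: cf|exact: cg].
move=> fk gk; have [f' g'] := (Ck_pred fk, Ck_pred gk).
case: fk gk => [df Df] [dg Dg]; split=> [x Ux|v].
  by apply: differentiableM; [exact: df|exact: dg].
apply: eq_Ck (CkD oU (IH _ _ f' (Dg v)) (IH _ _ g' (Df v))) => // x.
rewrite inE => Ux.
have := @deriveM _ _ (f : V -> R) g x v
  (diff_derivable (df _ Ux)) (diff_derivable (dg _ Ux)).
by rewrite /GRing.scale /= => <-.
Qed.

Lemma Ck_prod V k (I : Type) (r : seq I) (U : set V) (f : I -> V -> R^o) :
  open U -> (forall i, Ck_on k U (f i)) ->
  Ck_on k U (fun x => \prod_(i <- r) f i x : R^o).
Proof.
move=> oU fU; elim: r => [|i r IH].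
  by under eq_fun do rewrite big_nil; exact: Ck_cst.
by under eq_fun do rewrite big_cons; exact: CkM.
Qed.

Lemma CkN V W k (U : set V) (f : V -> W) : open U ->
  Ck_on k U f -> Ck_on k U (fun x => - f x).
Proof.
move=> oU fU; apply: (Ck_lin_comp (l := -%R)) => // [a b c|x].
  by rewrite opprD scalerN.
exact: oppr_continuous.
Qed.

(** The derivative of 1/f is -(1/f)^2 Df, and 1/f has class C^k by
    induction. *)
Lemma CkV V k (U : set V) (f : V -> R^o) : open U ->
  (forall x, U x -> f x != 0) ->
  Ck_on k U f -> Ck_on k U (fun x => (f x)^-1 : R^o).
Proof.
move=> oU f0; elim: k => [|k IH].
  by move=> cf x Ux; apply: cvgV; [exact: f0|exact: cf].
move=> fk; have {}IH := IH (Ck_pred fk).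
case: fk => [df Df]; split=> [x Ux|v].
  by apply: differentiableV; [exact: df|exact: f0].
apply: eq_Ck (CkN oU (CkM oU (CkM oU IH IH) (Df v))) => // x.
rewrite inE => Ux.
rewrite [RHS](@deriveV _ _ (f : V -> R) x v (f0 _ Ux)
  (diff_derivable (df _ Ux))).
by rewrite /GRing.scale /= mulNr -exprVn expr2.
Qed.

Lemma Ck_row V m k (U : set V) (f : V -> 'rV[R]_m) : open U ->
  (forall j, Ck_on k U (fun x => f x 0 j : R^o)) -> Ck_on k U f.
Proof.
move=> oU fU.
rewrite (_ : f = fun x => \sum_j f x 0 j *: (delta_mx 0 j : 'rV[R]_m)).
  apply: Ck_sum => // j.
  apply: (Ck_lin_comp (l := *:%R^~ 'e_j : R^o -> _)) => //.
    by move=> a b c; rewrite scalerDl -scalerA.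
  exact: scalel_continuous.
by apply/funext => x; exact: rV_expand.
Qed.

Lemma Ck_coord V m k (U : set V) (f : V -> 'rV[R]_m) j : open U ->
  Ck_on k U f -> Ck_on k U (fun x => f x 0 j : R^o).
Proof.
move=> oU fU; apply: (Ck_lin_comp (l := fun u : 'rV[R]_m => u 0 j)) => //.
  by move=> a u v; rewrite !mxE.
exact: coord_continuous.
Qed.

Lemma diff_expand m W (f : 'rV[R]_m -> W) x u : differentiable f x ->
  'd f x u = \sum_j u 0 j *: 'D_(delta_mx 0 j) f x.
Proof.
move=> df; rewrite {1}[u]rV_expand linear_sum; apply: eq_bigr => j _.
by rewrite linearZ deriveE.
Qed.

(** Since g is defined on R^m, the derivative of g o f along v is the finite
    sum of the (D_v f)_j times (D_j g) o f; each D_j g is one degree less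
    regular, so the induction closes with the product rule alone. *)
Lemma Ck_comp_scalar V m k (U : set V) (U' : set 'rV[R]_m) (f : V -> 'rV[R]_m)
    (g : 'rV[R]_m -> R^o) : open U -> open U' -> (forall x, U x -> U' (f x)) ->
  Ck_on k U f -> Ck_on k U' g -> Ck_on k U (g \o f).
Proof.
move=> oU oU' UU'; elim: k g => [|k IH] g.
  by move=> cf cg x Ux; apply: continuous_comp; [exact: cf|exact/cg/UU'].
move=> fk; have f' := Ck_pred fk; case: fk => df Df [dg Dg]; split=> [x Ux|v].
  by apply: differentiable_comp; [exact: df|exact/dg/UU'].
have H : Ck_on k U (fun x => \sum_j ('D_v f x) 0 j *
    ('D_(delta_mx 0 j) g \o f) x : R^o).
  apply: Ck_sum => // j.
  exact: (CkM oU (Ck_coord j oU (Df v)) (IH _ f' (Dg _))).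
apply: eq_Ck H => // x; rewrite inE => Ux.
have [dfx dgx] := (df x Ux, dg _ (UU' _ Ux)).
rewrite [RHS]deriveE; last exact: differentiable_comp.
by rewrite diff_comp_at// diff_expand// -deriveE.
Qed.

Lemma Ck_comp V m m' k (U : set V) (U' : set 'rV[R]_m) (f : V -> 'rV[R]_m)
    (g : 'rV[R]_m -> 'rV[R]_m') : open U -> open U' ->
  (forall x, U x -> U' (f x)) ->
  Ck_on k U f -> Ck_on k U' g -> Ck_on k U (g \o f).
Proof.
move=> oU oU' UU' fk gk; apply: Ck_row => // j.
exact: (Ck_comp_scalar oU oU' UU' fk (Ck_coord j oU' gk)).
Qed.

End Ck.

Section smooth.
Context (R : realType).
Implicit Types V W : normedModType R.

Lemma CkZ (V : normedModType R) m k (U : set V)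
    (f : V -> R^o) (g : V -> 'rV[R]_m) :
  open U -> Ck_on k U f -> Ck_on k U g -> Ck_on k U (fun x => f x *: g x).
Proof.
move=> oU fk gk; apply: Ck_row => // j.
apply: eq_Ck (CkM oU fk (Ck_coord j oU gk)) => // x _.
by rewrite mxE.
Qed.

Lemma Ck_dot (V : normedModType R) m k (U : set V) (f g : V -> 'rV[R]_m) :
  open U -> Ck_on k U f -> Ck_on k U g ->
  Ck_on k U (fun x => \sum_l f x 0 l * g x 0 l : R^o).
Proof.
by move=> oU fk gk; apply: Ck_sum => // l; apply: CkM => //; exact: Ck_coord.
Qed.

Lemma Ck_mulmx (V : normedModType R) m1 m2 k (U : set V) (f : V -> 'rV[R]_m1)
    (A : V -> 'M[R]_(m1, m2)) : open U -> Ck_on k U f ->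
  (forall i j, Ck_on k U (fun x => A x i j : R^o)) ->
  Ck_on k U (fun x => f x *m A x).
Proof.
move=> oU fk Ak; apply: Ck_row => // j.
apply: (@eq_Ck _ _ _ _ _ (fun x => \sum_l f x 0 l * A x l j : R^o)) => //.
  by move=> x _; rewrite mxE.
by apply: Ck_sum => // l; apply: CkM => //; exact: Ck_coord.
Qed.

Lemma Ck_row_mx (V : normedModType R) m1 m2 k (U : set V)
    (f : V -> 'rV[R]_m1) (g : V -> 'rV[R]_m2) : open U ->
  Ck_on k U f -> Ck_on k U g -> Ck_on k U (fun x => row_mx (f x) (g x)).
Proof.
move=> oU fk gk; apply: Ck_row => // j; case: (split_ordP j) => l ->.
  by apply: eq_Ck (Ck_coord l oU fk) => // x _; rewrite row_mxEl.
by apply: eq_Ck (Ck_coord l oU gk) => // x _; rewrite row_mxEr.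
Qed.

Lemma Ck_lsubmx m1 m2 k (U : set 'rV[R]_(m1 + m2)) : open U ->
  Ck_on k U (lsubmx : 'rV[R]_(m1 + m2) -> 'rV[R]_m1).
Proof.
by move=> oU; apply: (Ck_lin k (L := lsubmx) oU); exact: continuous_lsubmx.
Qed.

Lemma Ck_rsubmx m1 m2 k (U : set 'rV[R]_(m1 + m2)) : open U ->
  Ck_on k U (rsubmx : 'rV[R]_(m1 + m2) -> 'rV[R]_m2).
Proof.
by move=> oU; apply: (Ck_lin k (L := rsubmx) oU); exact: continuous_rsubmx.
Qed.

(** A differential applied to a moving vector at a moving point: this is how
    the components of a vector field change between charts. *)
Lemma smooth_diff_app V m m' (U : set V) (U' : set 'rV[R]_m) (t : V -> 'rV[R]_m)
    (f : 'rV[R]_m -> 'rV[R]_m') (h : V -> 'rV[R]_m) : open U -> open U' ->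
  (forall x, U x -> U' (t x)) -> smooth_on U t -> smooth_on U' f ->
  smooth_on U h -> smooth_on U (fun x => 'd f (t x) (h x)).
Proof.
move=> oU oU' UU' st sf sh k; apply: Ck_row => // i.
have H : Ck_on k U (fun x => \sum_j h x 0 j *
    (fun y => ('D_'e_j f y) 0 i) (t x) : R^o).
  apply: Ck_sum => // j; apply: (CkM oU (Ck_coord j oU (sh k))).
  exact: (Ck_comp_scalar oU oU' UU' (st k) (Ck_coord i oU' ((sf k.+1).2 _))).
apply: eq_Ck H => // x; rewrite inE => Ux.
rewrite diff_expand; last by apply: (sf 1%N).1; exact: UU'.
by rewrite summxE; apply: eq_bigr => j _; rewrite !mxE.
Qed.

Lemma Ck_det V n k (U : set V) (G : V -> 'M[R]_n) : open U ->
  (forall i j, Ck_on k U (fun x => G x i j : R^o)) ->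
  Ck_on k U (fun x => \det (G x) : R^o).
Proof.
move=> oU sG; apply: Ck_sum => // s; apply: CkM => //; first exact: Ck_cst.
by apply: Ck_prod.
Qed.

(** Cramer's rule: the entries of the inverse are cofactors over the
    determinant. *)
Lemma Ck_invmx V n k (U : set V) (G : V -> 'M[R]_n) : open U ->
  (forall x, U x -> G x \in unitmx) ->
  (forall i j, Ck_on k U (fun x => G x i j : R^o)) ->
  forall i j, Ck_on k U (fun x => invmx (G x) i j : R^o).
Proof.
move=> oU uG sG i j.
have H : Ck_on k U (fun x => (\det (G x))^-1 *
    ((-1) ^+ (j + i) * \det (row' j (col' i (G x)))) : R^o).
  apply: CkM => //.
    apply: CkV => //; last exact: Ck_det.
    by move=> x /uG; rewrite unitmxE unitfE.
  apply: CkM => //; first exact: Ck_cst.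
  apply: Ck_det => // a b; rewrite (_ : (fun _ => _) =
    fun x => G x (lift j a) (lift i b)) //.
  by apply/funext => x; rewrite !mxE.
by apply: eq_Ck H => // x; rewrite inE => Ux; rewrite /invmx uG// !mxE.
Qed.

End smooth.

(** * Differentials of coordinates and of dot products *)

Lemma diff_id_at (R : realType) (V : normedModType R) (x v : V) :
  differentiable (fun y : V => y) x /\ 'd (fun y : V => y) x v = v.
Proof.
split; first exact: (@ex_diff _ _ _ _ _ _ _ (is_diff_id x)).
exact: (congr1 (@^~ v) (@diff_val _ _ _ _ _ _ _ (is_diff_id x))).
Qed.

Section dot_derivative.
Context (R : realType) (V : normedModType R) (m : nat).
Implicit Types (f g : V -> 'rV[R]_m) (x v : V).

Lemma diff_coord f x v k : differentiable f x ->
  differentiable (fun y => f y 0 k : R^o) x /\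
  'd (fun y => f y 0 k : R^o) x v = ('d f x v) 0 k.
Proof.
move=> df.
have dc : differentiable (fun u : 'rV[R]_m => u 0 k : R^o) (f x).
  exact: differentiable_coord.
have [d e] := diff_comp_eq v erefl df dc; split=> //.
apply: etrans e _; have lk : linear (fun u : 'rV[R]_m => u 0 k : R^o).
  by move=> a u w; rewrite !mxE.
pose lM := GRing.isLinear.Build _ _ _ _ _ lk.
pose L : {linear _ -> _} := HB.pack (fun u : 'rV[R]_m => u 0 k : R^o) lM.
have cL : continuous L by exact: coord_continuous.
exact: (congr1 (@^~ _) (diff_lin _ cL)).
Qed.

Lemma diff_dot f g x v : differentiable f x -> differentiable g x ->
  differentiable (fun y => \sum_k f y 0 k * g y 0 k : R^o) x /\
  'd (fun y => \sum_k f y 0 k * g y 0 k : R^o) x v =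
  \sum_k (('d f x v) 0 k * g x 0 k + f x 0 k * ('d g x v) 0 k).
Proof.
move=> df dg; pose h (k : 'I_m) : V -> R^o := fun y => f y 0 k * g y 0 k.
have E : (fun y => \sum_k f y 0 k * g y 0 k : R^o) = \sum_k h k.
  by apply/funext => y; rewrite fct_sumE.
have dh k : differentiable (h k) x.
  by apply: differentiableM;
    [exact: (diff_coord v k df).1|exact: (diff_coord v k dg).1].
have ds : differentiable (\sum_k h k) x by exact: differentiable_sum.
rewrite E; split=> //.
apply: etrans (esym (deriveE v ds)) _.
rewrite derive_sum; last by move=> k; exact: diff_derivable.
apply: eq_bigr => k _.
have [df' ef] := diff_coord v k df; have [dg' eg] := diff_coord v k dg.
have eM := @deriveM _ _ (fun y => f y 0 k : R) (fun y => g y 0 k : R) x v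
  (diff_derivable df') (diff_derivable dg').
transitivity
  ('D_v ((fun y => f y 0 k : R) * (fun y => g y 0 k : R)) x : R) => //.
rewrite eM (deriveE v df') (deriveE v dg') addrC; congr (_ + _).
  by apply: etrans (mulrC _ _) _; exact: (congr1 (fun t => t * _) ef).
exact: (congr1 ( *%R _) eg).
Qed.

End dot_derivative.

Lemma continuous_dist (R : realType) n (c : 'rV[R]_n) :
  continuous (fun v : 'rV[R]_n => `|v - c|).
Proof.
have oT : open (setT : set 'rV[R]_n) by exact: openT.
move=> v; apply: (@continuous_comp _ _ _ (fun v : 'rV[R]_n => v - c)).
  exact: (CkD oT (Ck_id 0 oT) (Ck_cst 0 setT (- c)) v I).
exact: norm_continuous.
Qed.

Lemma open_norm_lt (R : realType) n (c : 'rV[R]_n) (r : R) :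
  open [set v : 'rV[R]_n | `|v - c| < r].
Proof.
have : open ((fun v : 'rV[R]_n => `|v - c|) @^-1` [set t | t < r]).
  by apply: open_comp => [v _|]; [exact: continuous_dist|exact: open_lt].
exact.
Qed.

Lemma closed_norm_le (R : realType) n (c : 'rV[R]_n) (r : R) :
  closed [set v : 'rV[R]_n | `|v - c| <= r].
Proof.
have : closed ((fun v : 'rV[R]_n => `|v - c|) @^-1` [set t | t <= r]).
  apply: preimage_closed; last exact: closed_le.
  by move=> v _; exact: continuous_dist.
exact.
Qed.

(** * Smooth bump functions *)

Section bump.
Context (R : realType).

(** t^-k exp(-1/t), extended by 0.  The powers make the family closed under
    differentiation. *)
Definition exp_inv (k : nat) (t : R) : R :=
  if 0 < t then t^-1 ^+ k * expR (- t^-1) else 0.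

(** A quadratic bound, which gives derivative 0 at the origin.  It comes from
    exp(1/t) >= t^-(k+2) / (k+2)!. *)
Lemma exp_inv_bound k (t : R) : `|exp_inv k t| <= k.+2`!%:R * t ^+ 2.
Proof.
rewrite /exp_inv; case: ifPn => [t0|_]; last first.
  by rewrite normr0 mulr_ge0 ?sqr_ge0.
have ti0 : 0 <= t^-1 by rewrite invr_ge0 ltW.
have := expR_ge1Dxn k.+1 ti0.
rewrite ger0_norm ?mulr_ge0 ?exprn_ge0 ?expR_ge0//.
set c := k.+2`!%:R; have c0 : 0 < c by rewrite ltr0n fact_gt0.
move=> H; rewrite expRN.
rewrite ler_pdivrMr ?expR_gt0//.
have {H} : t^-1 ^+ k.+2 / c <= expR t^-1 by apply: le_trans H; rewrite lerDr.
rewrite ler_pdivrMr// => H.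
have -> : t^-1 ^+ k = t ^+ 2 * t^-1 ^+ k.+2.
  by rewrite -(addn2 k) exprD mulrCA -exprMn divff ?expr1n ?mulr1// gt_eqF.
by rewrite (mulrC c) -(mulrA _ c) ler_pM2l ?exprn_gt0// mulrC.
Qed.

Lemma is_derive_exp_inv k (t : R) :
  is_derive t (1 : R) (exp_inv k) (exp_inv k.+2 t - k%:R * exp_inv k.+1 t).
Proof.
have [t0|t0|<-] := ltgtP 0 t; last first.
- have c0 : h^-1 *: (exp_inv k (h *: 1 + 0) - exp_inv k 0)
      @[h --> 0^'] --> (0 : R).
    apply/cvgrPdist_le => e e0; near=> h.
    have h0 : h != 0 by near: h; exact: nbhs_dnbhs_neq.
    rewrite sub0r normrN {2}/exp_inv ltxx subr0 addr0 [_ *: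
      1]mulr1 normrM normfV.
    rewrite ler_pdivrMl ?normr_gt0//; apply: (le_trans (exp_inv_bound k h)).
    rewrite -real_normK ?num_real// expr2 mulrA mulrC ler_pM2l ?normr_gt0//.
    rewrite -ler_pdivlMl ?ltr0n ?fact_gt0//.
    by near: h; apply: dnbhs0_le; rewrite mulr_gt0// invr_gt0 ltr0n fact_gt0.
  rewrite {2 3}/exp_inv ltxx mulr0 subr0.
  apply: DeriveDef.
    by apply/cvg_ex; exists 0.
  exact: cvg_lim c0.
- apply: (@near_eq_is_derive _ _ _ (cst 0)).
    have : nbhs t [set s : R | s < 0] by apply: open_nbhs_nbhs; split.
    by apply: filterS => s /= s0; rewrite /exp_inv ltNge ltW.
  by rewrite /exp_inv ltNge (ltW t0)/= mulr0 subr0; exact: is_derive_cst.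
apply: (@near_eq_is_derive R R R (fun s => s^-1 ^+ k * expR (- s^-1))).
  have : nbhs t [set s : R | 0 < s] by apply: open_nbhs_nbhs; split.
  by apply: filterS => s /= s0; rewrite /exp_inv s0.
rewrite /exp_inv t0.
have tn0 : (id : R -> R) t != 0 by rewrite gt_eqF.
have dV := is_deriveV tn0 (is_derive_id t (1 : R)).
have dE := is_derive1_comp (g := fun s => - s^-1)
  (is_derive_expR (- t^-1)) (is_deriveN dV).
have /is_derive_eq := is_deriveM (is_deriveX k dV) dE; rewrite exprfctE; apply.
case: k => [|k]; rewrite !fctE /= /GRing.scale /=.
  rewrite !mul0r !mulr0 !expr0 !mul1r; field; exact: tn0.
rewrite !exprS expr0 -natr1; move: (expR _) (t^-1 ^+ k) => a b.
by field; exact: tn0.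
Unshelve. all: by end_near. Qed.

(** Proved for all k at once, since the derivative of the k-th function of the
    family involves the two next ones. *)
Lemma Ck_exp_inv (V : normedModType R) k m (U : set V) (f : V -> R^o) :
  open U ->
  Ck_on m U f -> Ck_on m U (fun x => exp_inv k (f x) : R^o).
Proof.
move=> oU; elim: m k f => [|m IH] k f.
  move=> cf x Ux; apply: continuous_comp; first exact: cf.
  apply: differentiable_continuous; apply/derivable1_diffP.
  exact: (@ex_derive _ _ _ _ _ _ _ (is_derive_exp_inv k _)).
move=> fm; have f' := Ck_pred fm; case: fm => df Df.
have d_exp_inv y : differentiable (exp_inv k : R^o -> R^o) y.
  apply/derivable1_diffP.
  exact: (@ex_derive _ _ _ _ _ _ _ (is_derive_exp_inv k _)).
split=> [x Ux|v].
  by apply: differentiable_comp; [exact: df|exact: d_exp_inv].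
have H : Ck_on m U (fun x => 'D_v f x *
    (exp_inv k.+2 (f x) + - (k%:R * exp_inv k.+1 (f x))) : R^o).
  apply: (CkM oU (Df v)); apply: (CkD oU (IH _ _ f')); apply: (CkN oU).
  by apply: CkM => //; [exact: Ck_cst|exact: IH].
apply: eq_Ck H => // x; rewrite inE => Ux.
rewrite [RHS]deriveE; last first.
  by apply: differentiable_comp; [exact: df|exact: d_exp_inv].
rewrite (diff_comp_at v (df x Ux) (d_exp_inv (f x))) (deriveE _ (df x Ux)).
rewrite (diff1E (d_exp_inv (f x))) derive1E.
by rewrite (@derive_val _ _ _ _ _ _ _ (is_derive_exp_inv k _)).
Qed.

Lemma exp_inv_gt0 k (t : R) : 0 < t -> 0 < exp_inv k t.
Proof.
by move=> t0; rewrite /exp_inv t0 mulr_gt0 ?expR_gt0// exprn_gt0// invr_gt0.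
Qed.

Lemma exp_inv_le0 k (t : R) : t <= 0 -> exp_inv k t = 0.
Proof. by move=> t0; rewrite /exp_inv ltNge t0. Qed.

Lemma exp_inv_ge0 k (t : R) : 0 <= exp_inv k t.
Proof. by case: (ltP 0 t) => [/(exp_inv_gt0 k)/ltW//|/exp_inv_le0->]. Qed.

(** The denominator never vanishes because t < 2 or t > 1. *)
Definition plateau (t : R) : R :=
  exp_inv 0 (2 - t) / (exp_inv 0 (2 - t) + exp_inv 0 (t - 1)).

Lemma plateau_denom (t : R) : exp_inv 0 (2 - t) + exp_inv 0 (t - 1) != 0.
Proof.
rewrite gt_eqF//; case: (ltP t 2) => t2.
  by rewrite ltr_wpDr ?exp_inv_ge0// exp_inv_gt0// subr_gt0.
rewrite ltr_wpDl ?exp_inv_ge0// exp_inv_gt0// subr_gt0.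
by apply: lt_le_trans t2; rewrite ltr1n.
Qed.

Lemma plateau1 (t : R) : t <= 1 -> plateau t = 1.
Proof.
move=> t1; have := plateau_denom t;
  rewrite /plateau (exp_inv_le0 _ (t := t - 1)).
  by rewrite addr0 => /divff.
by rewrite subr_le0.
Qed.

Lemma plateau0 (t : R) : 2 <= t -> plateau t = 0.
Proof. by move=> t2; rewrite /plateau exp_inv_le0 ?mul0r// subr_le0. Qed.

Lemma Ck_plateau (V : normedModType R) m (U : set V) (f : V -> R^o) : open U ->
  Ck_on m U f -> Ck_on m U (fun x => plateau (f x) : R^o).
Proof.
move=> oU sf.
have s2 : Ck_on m U (fun x => exp_inv 0 (2 - f x) : R^o).
  by apply: Ck_exp_inv => //; apply: CkD => //; [exact: Ck_cst|exact: CkN].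
have s1 : Ck_on m U (fun x => exp_inv 0 (f x - 1) : R^o).
  by apply: Ck_exp_inv => //; apply: CkD => //; exact: Ck_cst.
apply: CkM => //; apply: CkV => //; last exact: CkD.
by move=> x _; exact: plateau_denom.
Qed.

Lemma rV_norm_le n (u : 'rV[R]_n) (c : R) : 0 <= c ->
  (forall i, `|u 0 i| <= c) -> `|u| <= c.
Proof.
move=> c0 H; rewrite /Num.Def.normr/= mx_normrE.
by apply: bigmax_le => // -[i j] _ /=; rewrite ord1.
Qed.

Lemma rV_coord_le n (u : 'rV[R]_n) i : `|u 0 i| <= `|u|.
Proof.
rewrite [leRHS]/Num.Def.normr/= mx_normrE.
exact: (@le_bigmax _ _ _ _ (fun ij => `|u ij.1 ij.2|) (0, i)).
Qed.

(** The plateau is taken at 2|u - u0|^2 / r^2 for the Euclidean norm, which is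
    smooth; if the sup norm of u - u0 exceeds r, then one coordinate alone
    brings this quantity above 2. *)
Lemma bump_exists n (u0 : 'rV[R]_n) (r : R) : 0 < r ->
  exists b : 'rV[R]_n -> R^o, [/\ smooth_on setT b,
    \forall u \near u0, b u = 1 &
    forall u, r < `|u - u0| -> b u = 0].
Proof.
move=> r0; pose t (u : 'rV[R]_n) : R^o :=
  \sum_i (u 0 i - u0 0 i) ^+ 2 * (2 / r ^+ 2).
have st k : Ck_on k setT t.
  apply: Ck_sum; [exact: openT|] => i.
  have sc : Ck_on k setT (fun u : 'rV[R]_n => u 0 i - u0 0 i : R^o).
    apply: CkD; [exact: openT| |exact: Ck_cst].
    by apply: Ck_coord; [exact: openT|apply: Ck_id; exact: openT].
  apply: CkM; [exact: openT| |exact: Ck_cst].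
  exact: (CkM (openT : open setT) sc sc).
exists (fun u => plateau (t u)); split.
- by move=> k; apply: Ck_plateau; [exact: openT|exact: st].
- have ct : {for u0, continuous t} by exact: (st 0%N).
  have : nbhs (t u0) [set s : R | s < 1].
    apply: open_nbhs_nbhs; split; first exact: open_lt.
    by rewrite /t big1 /= ?ltr01// => i _; rewrite subrr expr0n mul0r.
  by move/ct; apply: (@filterS _ (nbhs u0)) => u /= /ltW/plateau1.
- move=> u ru; apply: plateau0.
  have [i ri] : exists i, r < `|(u - u0) 0 i|.
    apply: contrapT => /forallNP H; move: ru; rewrite ltNge => /negP; apply.
    by apply: rV_norm_le; [exact: ltW|move=> i; rewrite leNgt; exact/negP/H].
  rewrite /t (bigD1 i)//= -[leLHS]addr0 lerD//.
    rewrite mulrCA -[leLHS]mulr1 ler_wpM2l ?ler0n// ler_pdivlMr ?exprn_gt0//.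
    rewrite mul1r -(real_normK (num_real (_ - _))) ler_sqr ?nnegrE ?(ltW r0)//.
    by move: ri; rewrite !mxE => /ltW.
  apply: sumr_ge0 => j _; rewrite mulr_ge0 ?sqr_ge0// divr_ge0 ?ler0n//.
  exact: sqr_ge0.
Qed.

End bump.

(** * Choice and topology *)

Lemma the_unique (V : zmodType) (P : set V) (x : V) :
  P x -> (forall y, P y -> y = x) -> the P = x.
Proof. by move=> Px Pu; apply: Pu; apply: xgetPex; exists x. Qed.

(** Separation of points through a continuous map; the Hausdorff property is
    stated in terms of cluster points. *)
Lemma cluster_image (T S : topologicalType) (f : T -> S) (a b : T) :
  {for a, continuous f} -> {for b, continuous f} ->
  cluster (nbhs a) b -> cluster (nbhs (f a)) (f b).
Proof.
move=> ca cb ab A B /ca nA /cb nB.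
by have [c [Ac Bc]] := ab _ _ nA nB; exists (f c).
Qed.

Lemma dot_delta (R : realType) n (u : 'rV[R]_n) k :
  \sum_j u 0 j * ('e_k : 'rV_n) 0 j = u 0 k.
Proof.
rewrite (bigD1 k)//= [X in _ + X]big1 => [|j /negPf jk].
  by rewrite mxE !eqxx mulr1 addr0.
by rewrite mxE jk andbF mulr0.
Qed.

Lemma open_near (T : topologicalType) (A : set T) (x : T) :
  open A -> A x -> \near x, A x.
Proof. by move=> oA Ax; exact: open_nbhs_nbhs. Qed.

(** * Charts and transition maps *)

Section charts.
Context (R : realType) (n : nat) (M : charted R n).
Hypothesis hM : smooth_manifold M.
Implicit Types (i j k : chart_index M) (x : M) (u : 'rV[R]_n).

Let hchart i : is_chart i. Proof. by case: hM. Qed.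

Lemma chart_cover x : exists i, chart_dom i x.
Proof. by case: hM. Qed.

Lemma open_chart_dom i : open (chart_dom i).
Proof. by case: (hchart i). Qed.
(* Openness unfolds to a product, so its subject would become implicit. *)
Arguments open_chart_dom : clear implicits.

Lemma open_chart_img i : open (chart_img i).
Proof. by case: (hchart i). Qed.
Arguments open_chart_img : clear implicits.

Lemma continuous_chart_map i x :
  chart_dom i x -> {for x, continuous (chart_map i)}.
Proof. by case: (hchart i) => _ _ _ + _; exact. Qed.

Lemma continuous_chart_inv i u :
  chart_img i u -> {for u, continuous (chart_inv i)}.
Proof. by case: (hchart i) => _ _ _ _; exact. Qed.

Lemma chart_imgP i x : chart_dom i x -> chart_img i (chart_map i x).
Proof. by exists x. Qed.

Lemma chart_mapK i x : chart_dom i x -> chart_inv i (chart_map i x) = x.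
Proof. by case: (hchart i) => _ _ + _ _; exact. Qed.

Lemma chart_invP i u : chart_img i u -> chart_dom i (chart_inv i u).
Proof. by move=> [x xi <-]; rewrite chart_mapK. Qed.

Lemma chart_invK i u : chart_img i u -> chart_map i (chart_inv i u) = u.
Proof. by move=> [x xi <-]; rewrite chart_mapK. Qed.

(** Openness of the coordinate image of an open set. *)
Lemma open_chart_preim i (O : set M) : open O ->
  open (chart_img i `&` chart_inv i @^-1` O).
Proof.
move=> oO; rewrite openE => u [iu Ou]; apply: filterI.
  exact: (open_near (open_chart_img i) iu).
by apply: (continuous_chart_inv iu); exact: (open_near oO Ou).
Qed.
Arguments open_chart_preim : clear implicits.

Lemma near_chart i x (O : set M) : open O -> chart_dom i x -> O x ->
  \forall u \near chart_map i x, chart_img i u /\ O (chart_inv i u).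
Proof.
move=> oO xi Ox; have oP := open_chart_preim i _ oO.
suff : (chart_img i `&` chart_inv i @^-1` O) (chart_map i x).
  by move=> H; exact: (open_near oP H).
by split; [exact: chart_imgP|rewrite /= chart_mapK].
Qed.

Definition transition i j : 'rV[R]_n -> 'rV[R]_n := chart_map j \o chart_inv i.

Definition overlap i j : set 'rV[R]_n :=
  chart_img i `&` chart_inv i @^-1` chart_dom j.

Lemma open_overlap i j : open (overlap i j).
Proof. exact: (open_chart_preim i _ (open_chart_dom j)). Qed.
Arguments open_overlap : clear implicits.

Lemma overlapP i j x : chart_dom i x -> chart_dom j x ->
  overlap i j (chart_map i x).
Proof. by move=> xi xj; split; [exact: chart_imgP|rewrite /= chart_mapK]. Qed.

Lemma transition_inv i j u : overlap i j u ->
  chart_inv j (transition i j u) = chart_inv i u.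
Proof. by move=> [iu ju]; rewrite /transition /= chart_mapK. Qed.

Lemma overlap_transition i j u : overlap i j u ->
  overlap j i (transition i j u).
Proof.
move=> [iu ju]; apply: overlapP => //; exact: chart_invP.
Qed.

Lemma transitionE i j x : chart_dom i x ->
  transition i j (chart_map i x) = chart_map j x.
Proof. by move=> xi; rewrite /transition /= chart_mapK. Qed.

Lemma smooth_transition i j : smooth_on (overlap i j) (transition i j).
Proof.
have -> : overlap i j = chart_map i @` (chart_dom i `&` chart_dom j).
  rewrite eqEsubset; split => u.
    by move=> [[x xi <-]]; rewrite /= chart_mapK// => xj; exists x.
  by move=> [x [xi xj] <-]; exact: overlapP.
by case: hM => _ _ _ _; exact.
Qed.
Arguments smooth_transition : clear implicits.

Lemma transition_differentiable i j x : chart_dom i x -> chart_dom j x ->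
  differentiable (transition i j) (chart_map i x).
Proof. by move=> xi xj;
  exact: ((smooth_transition i j 1%N).1 _ (overlapP xi xj)). Qed.

Lemma near_overlap i j x : chart_dom i x -> chart_dom j x ->
  \forall u \near chart_map i x, overlap i j u.
Proof.
by move=> xi xj; exact: (open_near (open_overlap i j) (overlapP xi xj)).
Qed.

(** The cocycle condition.  It makes the family of coordinate vectors that is
    obtained from one chart a tangent vector. *)
Lemma diff_transition_comp i j k x u :
  chart_dom i x -> chart_dom j x -> chart_dom k x ->
  'd (transition j k) (chart_map j x) ('d (transition i j) (chart_map i x) u) =
  'd (transition i k) (chart_map i x) u.
Proof.
move=> xi xj xk; have dij := transition_differentiable xi xj.
have djk := transition_differentiable xj xk.
have E : {near chart_map i x, (fun y => transition j k (transition i j y)) =1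
    transition i k}.
  near=> y; have yij : overlap i j y by near: y; exact: near_overlap.
  by rewrite {1}/transition /= transition_inv.
have [dc e] := diff_comp_eq u (transitionE j xi) dij djk.
have [_ e'] := near_eq_diff E dc.
apply: etrans (esym e) _; exact: (congr1 (@^~ u) (esym e')).
Unshelve. all: by end_near. Qed.

Lemma diff_transition_id i x u :
  chart_dom i x -> 'd (transition i i) (chart_map i x) u = u.
Proof.
move=> xi; have E : {near chart_map i x, id =1 transition i i}.
  near=> y; have [yi _] : overlap i i y by near: y; exact: near_overlap.
  by rewrite /transition /= chart_invK.
have [did eid] := diff_id_at (chart_map i x) u.
have [_ e] := near_eq_diff E did; exact: etrans (congr1 (@^~ u) e) eid.
Unshelve. all: by end_near. Qed.

End charts.
Arguments open_chart_dom {R n M} hM i.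
Arguments open_chart_img {R n M} hM i.
Arguments open_overlap {R n M} hM i j.
Arguments open_chart_preim {R n M} hM i O.
Arguments smooth_transition {R n M} hM i j.

(** * Tangent vectors and covectors in coordinates *)

Section tangents.
Context (R : realType) (n : nat) (M : charted R n).
Hypothesis hM : smooth_manifold M.
Implicit Types (i j k : chart_index M) (u : 'rV[R]_n).
Variable x : M.
Implicit Types v w : tangent x.

Lemma tangentP v i j : chart_dom i x -> chart_dom j x ->
  v j = 'd (transition i j) (chart_map i x) (v i).
Proof. by case: v => v /= /asboolP[_]; exact. Qed.

Lemma tangent_out v i : ~ chart_dom i x -> v i = 0.
Proof. by case: v => v /= /asboolP[+ _]; exact. Qed.

Lemma tangent_ext i v w : chart_dom i x -> v i = w i -> v = w.
Proof.
move=> xi vw; apply: val_inj; apply/funext => j /=.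
have [xj|xj] := pselect (chart_dom j x); last by rewrite !tangent_out.
by rewrite !(tangentP _ xi xj) vw.
Qed.

(** The vector exists because the cocycle condition holds, and is unique since
    its coordinates in the other charts are determined by those in one. *)
Lemma coord_vecE i u : chart_dom i x -> coord_vec x i u i = u.
Proof.
move=> xi.
pose f j := if `[< chart_dom j x >] then
  'd (transition i j) (chart_map i x) u else 0.
have fE j : chart_dom j x -> f j = 'd (transition i j) (chart_map i x) u.
  by move=> xj; rewrite /f asboolT.
have fP : f \in @tangent_pred R n M x.
  apply/asboolP; split=> [j xj|j k xj xk]; first by rewrite /f asboolF.
  by rewrite !fE//; exact: (esym (diff_transition_comp hM u xi xj xk)).
pose v : tangent x := Tangent fP.
have vi : v i = u by rewrite /v /= fE//; exact: diff_transition_id.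
rewrite /coord_vec (the_unique (x := v))// => w wi.
by apply: (tangent_ext xi); rewrite vi.
Qed.

Lemma coord_vecK i v : chart_dom i x -> coord_vec x i (v i) = v.
Proof. by move=> xi; apply: (tangent_ext xi); rewrite coord_vecE. Qed.

Lemma tangentD v w i : (v + w) i = v i + w i.
Proof. by []. Qed.

Lemma tangentZ (a : R) v i : (a *: v) i = a *: v i.
Proof. by []. Qed.

Lemma tangent0 i : (0 : tangent x) i = 0.
Proof. by []. Qed.

Lemma tangent_sum (I : Type) (r : seq I) (P : pred I) (F : I -> tangent x) i :
  (\sum_(k <- r | P k) F k) i = \sum_(k <- r | P k) F k i.
Proof. by apply: (big_morph (fun v : tangent x => v i)). Qed.

Lemma coord_vec_linear i a u u' : chart_dom i x ->
  coord_vec x i (a *: u + u') = a *: coord_vec x i u + coord_vec x i u'.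
Proof.
by move=> xi; apply: (tangent_ext xi); rewrite tangentD tangentZ !coord_vecE.
Qed.

Lemma coord_vec_expand i v : chart_dom i x ->
  v = \sum_k v i 0 k *: coord_vec x i 'e_k.
Proof.
move=> xi; apply: (tangent_ext xi); rewrite tangent_sum {1}[v i]rV_expand.
by apply: eq_bigr => k _; rewrite tangentZ coord_vecE.
Qed.

Implicit Types a b : cotangent x.

Lemma cotangentP b : scalar b.
Proof. by case: b => b /= /asboolP. Qed.

HB.instance Definition _ b :=
  GRing.isLinear.Build R (tangent x) R^o _ (coform b) (cotangentP b).

Lemma cotangent_ext a b : (forall v, a v = b v) -> a = b.
Proof. by move=> ab; apply: val_inj; apply/funext. Qed.

Lemma cotangentD a b v : (a + b) v = a v + b v.
Proof. by []. Qed.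

Lemma cotangentZ (c : R) a v : (c *: a) v = c * a v.
Proof. by []. Qed.

Lemma cotangentE i a v : chart_dom i x ->
  a v = \sum_k cocoord i a 0 k * v i 0 k.
Proof.
move=> xi; rewrite {1}(coord_vec_expand v xi) linear_sum.
by apply: eq_bigr => k _; rewrite linearZ mxE mulrC.
Qed.

Lemma exists_cotangent (f : tangent x -> R^o) : scalar f ->
  exists b : cotangent x, forall v, b v = f v.
Proof.
move=> lf; have fP : f \in @cotangent_pred R n M x by apply/asboolP.
by exists (Cotangent fP).
Qed.

Lemma coord_covecE i u v : chart_dom i x ->
  coord_covec x i u v = \sum_k u 0 k * v i 0 k.
Proof.
move=> xi.
have [|b bE] := @exists_cotangent (fun v => \sum_k u 0 k * v i 0 k).
  move=> c v1 v2; rewrite [c * _]mulr_sumr -big_split; apply: eq_bigr => k _.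
  by rewrite tangentD tangentZ !mxE mulrDr mulrCA.
rewrite /coord_covec (the_unique (x := b))// => b' b'E.
by apply: cotangent_ext => w; rewrite bE b'E.
Qed.

Lemma cocoord_covec i u : chart_dom i x -> cocoord i (coord_covec x i u) = u.
Proof.
move=> xi; apply/rowP => k; rewrite mxE coord_covecE// coord_vecE//.
exact: dot_delta.
Qed.

Lemma coord_covecK i a : chart_dom i x -> coord_covec x i (cocoord i a) = a.
Proof.
by move=> xi; apply: cotangent_ext => v; rewrite coord_covecE// -cotangentE.
Qed.

Lemma cocoord_ext i a b : chart_dom i x -> cocoord i a = cocoord i b -> a = b.
Proof. by move=> xi ab; rewrite -(coord_covecK a xi) ab coord_covecK. Qed.

Lemma cocoordD i a b : cocoord i (a + b) = cocoord i a + cocoord i b.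
Proof. by apply/rowP => k; rewrite !mxE cotangentD. Qed.

Lemma cocoordZ i (c : R) a : cocoord i (c *: a) = c *: cocoord i a.
Proof. by apply/rowP => k; rewrite !mxE cotangentZ. Qed.

(** Covectors transform by the transposed differential of the inverse
    transition map, so smoothness of the change of components needs no matrix
    inversion. *)
Lemma cocoord_transition i j a (m : 'I_n) : chart_dom i x -> chart_dom j x ->
  cocoord j a 0 m =
  \sum_l cocoord i a 0 l * ('d (transition j i) (chart_map j x) 'e_m) 0 l.
Proof.
move=> xi xj; rewrite {1}/cocoord mxE (cotangentE _ _ xi).
by apply: eq_bigr => l _; rewrite (tangentP _ xj xi) coord_vecE.
Qed.

End tangents.

(** * Tangent maps and derivatives computed in one chart *)

Section pushforward.
Context (R : realType) (m n : nat) (M : charted R m) (N : charted R n).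
Hypotheses (hM : smooth_manifold M) (hN : smooth_manifold N).
Implicit Types (F : M -> N) (x : M) (y : N).

(** The defining condition ranges over all pairs of charts; by the chain rule
    one pair suffices. *)
Lemma pushforward_chart F x y (v : tangent x) (w : tangent y) i0 j0 :
  F x = y -> chart_dom i0 x -> chart_dom j0 y ->
  (\forall u \near chart_map i0 x, chart_dom j0 (F (chart_inv i0 u))) ->
  differentiable (chart_map j0 \o F \o chart_inv i0) (chart_map i0 x) ->
  w j0 = 'd (chart_map j0 \o F \o chart_inv i0) (chart_map i0 x) (v i0) ->
  Defs.pushforward F v w.
Proof.
move=> Fx xi0 yj0 nF dF wj0; split=> // i j xi yj.
pose f := chart_map j0 \o F \o chart_inv i0.
have dt := transition_differentiable hM xi xi0.
have [d1 e1] := diff_comp_eq (v i) (transitionE hM i0 xi) dt dF.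
have fx : f (transition i i0 (chart_map i x)) = chart_map j0 y.
  by rewrite transitionE// /f /= chart_mapK// Fx.
have dt' := transition_differentiable hN yj0 yj.
have [d2 e2] := diff_comp_eq (f := fun u => f (transition i i0 u)) (v i)
  fx d1 dt'.
have nF' : \forall u \near chart_map i x,
    chart_dom j0 (F (chart_inv i0 (transition i i0 u))).
  apply: (differentiable_continuous dt
    (t := fun u => chart_dom j0 (F (chart_inv i0 u)))).
  by rewrite transitionE.
have E : {near chart_map i x,
    (fun u => transition j0 j (f (transition i i0 u))) =1
    chart_map j \o F \o chart_inv i}.
  near=> u; have ui : overlap i i0 u by near: u; exact: near_overlap.
  have Fu : chart_dom j0 (F (chart_inv i0 (transition i i0 u))) by near: u.
  rewrite /f /transition /= chart_mapK//; congr (chart_map j (F _)).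
  exact: transition_inv.
have [_ e] := near_eq_diff E d2.
rewrite e [RHS]e2 (tangentP w yj0 yj) wj0; congr ('d _ _ _).
by rewrite [RHS]e1 (tangentP v xi xi0).
Unshelve. all: by end_near. Qed.

End pushforward.

Section deriv_along.
Context (R : realType) (n : nat) (M : charted R n).
Hypothesis hM : smooth_manifold M.

(** All charts give the same derivative, again by the chain rule, so the
    defining condition has a solution. *)
Lemma deriv_alongE (f : M -> R) x (v : tangent x) i : chart_dom i x ->
  differentiable (f \o chart_inv i : 'rV[R]_n -> R^o) (chart_map i x) ->
  deriv_along f v =
    'd (f \o chart_inv i : 'rV[R]_n -> R^o) (chart_map i x) (v i).
Proof.
move=> xi df; apply: the_unique => [j xj|d]; last exact.
have [dc e] := diff_comp_eq (v j) (transitionE hM i xj)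
  (transition_differentiable hM xj xi) df.
have E : {near chart_map j x,
    (fun u => (f \o chart_inv i : _ -> R^o) (transition j i u)) =1
    (f \o chart_inv j : _ -> R^o)}.
  near=> u; have ui : overlap j i u by near: u; exact: near_overlap.
  by rewrite /= transition_inv.
have [_ e'] := near_eq_diff E dc.
apply: esym; apply: etrans (congr1 (@^~ (v j)) e') _; apply: etrans e _.
exact: congr1 (esym (tangentP v xj xi)).
Unshelve. all: by end_near. Qed.

End deriv_along.

(** * Cutoff functions and extension of local fields *)

Section cutoffs.
Context (R : realType) (n : nat) (M : charted R n).
Hypothesis hM : smooth_manifold M.
Implicit Types (i j k : chart_index M) (x : M) (u : 'rV[R]_n).

(** N is a neighbourhood on which phi is constantly 1, so that multiplying
    by phi does not change germs at the points of N. *)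
Record cutoff i (phi : M -> R) (N : set M) : Prop := Cutoff {
  cutoff_open : open N;
  cutoff_sub : N `<=` chart_dom i;
  cutoff1 : forall x, N x -> phi x = 1;
  cutoff_smooth : smooth_fun phi;
  cutoff_supp : exists2 C, closed C /\ C `<=` chart_dom i &
    forall x, ~ C x -> phi x = 0
}.

(** Extension by zero.  Since C is closed, the points where F is known to
    vanish form an open set. *)
Lemma glue_smooth (W : normedModType R) (F : 'rV[R]_n -> W) i j (C : set M) :
  closed C -> C `<=` chart_dom i ->
  (forall u, chart_img j u -> ~ C (chart_inv j u) -> F u = 0) ->
  smooth_on (overlap j i) F -> smooth_on (chart_img j) F.
Proof.
move=> cC Ci F0 sF k; apply: Ck_local => u ju.
have [ui|ui] := pselect (chart_dom i (chart_inv j u)).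
  by exists (overlap j i) => //; split.
exists (chart_img j `&` chart_inv j @^-1` (~` C)); first by split=> // /Ci.
apply: (@eq_Ck _ _ _ _ _ (fun=> 0)); last exact: Ck_cst.
  by apply: open_chart_preim => //; exact: closed_openC.
by move=> w /[1!inE] -[jw Cw]; rewrite F0.
Qed.

Lemma glue_cutoff (W : normedModType R) (F : 'rV[R]_n -> W) i j phi N :
  cutoff i phi N ->
  (forall u, chart_img j u -> phi (chart_inv j u) = 0 -> F u = 0) ->
  smooth_on (overlap j i) F -> smooth_on (chart_img j) F.
Proof.
move=> [_ _ _ _ [C [cC Ci] C0]] F0; apply: glue_smooth cC Ci _ => u ju Cu.
exact/F0/C0.
Qed.

Lemma compact_chart_inv i (K : set 'rV[R]_n) : K `<=` chart_img i ->
  compact K -> compact (chart_inv i @` K).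
Proof.
move=> Ki cK; apply: continuous_compact cK; apply: continuous_in_subspaceT => u.
by rewrite inE => /Ki; exact: continuous_chart_inv.
Qed.

(** The support is the image of a compact ball, hence compact, hence closed
    because M is Hausdorff. *)
Lemma cutoff_exists i x0 : chart_dom i x0 ->
  exists phi N, cutoff i phi N /\ N x0.
Proof.
move=> x0i; set u0 := chart_map i x0.
have : nbhs u0 (chart_img i).
  exact: (open_near (open_chart_img hM i) (chart_imgP x0i)).
move=> /nbhs_normP[r /= r0 ri].
have r20 : 0 < r / 2 by rewrite divr_gt0.
have [b [sb b1 b0]] := bump_exists u0 r20.
(* Half of the radius, so that the closed ball stays in the open image. *)
pose K := [set u : 'rV[R]_n | `|u - u0| <= r / 2].
have Ki : K `<=` chart_img i.
  move=> u Ku; apply: ri; rewrite /= distrC (le_lt_trans Ku)//.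
  by rewrite ltr_pdivrMr// ltr_pMr// ltr1n.
have cK : compact K.
  apply: bounded_closed_compact.
    exists (`|u0| + r / 2); split; first exact: num_real.
    move=> c Hc u Ku; apply: le_trans (ltW Hc).
    by rewrite -[u in leLHS](subrK u0) addrC (le_trans
      (ler_normD _ _))// lerD2l.
  exact: closed_norm_le.
pose C := chart_inv i @` K.
have cC : closed C.
  by apply: compact_closed; [case: hM|exact: compact_chart_inv].
have Ci : C `<=` chart_dom i.
  by move=> _ [u Ku <-]; exact/(chart_invP hM)/Ki.
pose phi x : R := if `[< chart_dom i x >] then b (chart_map i x) else 0.
have phiC x : ~ C x -> phi x = 0.
  rewrite /phi; case: asboolP => // xi Cx; apply: b0; rewrite ltNge; apply/negP.
  by move=> H; apply: Cx; exists (chart_map i x); rewrite ?chart_mapK.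
have [B [oB Bu0] Bb] : exists2 B, open B /\ B u0 & B `<=` [set u | b u = 1].
  exists (interior [set u | b u = 1]); last exact: interior_subset.
  by split; [exact: open_interior|exact: b1].
exists phi, (chart_dom i `&` chart_map i @^-1` B); split; last by split.
split.
- rewrite openE => x [xi Bx]; apply: filterI.
    exact: open_near (open_chart_dom hM i) xi.
  by apply: (continuous_chart_map hM xi); exact: open_near oB Bx.
- by move=> x [].
- by move=> x [xi Bx]; rewrite /phi asboolT//; exact: Bb.
- move=> j; apply: (glue_smooth cC Ci); first by move=> u _ /phiC.
  move=> k; have oo := open_overlap hM j i.
  apply: eq_Ck (Ck_comp_scalar oo (openT : open setT) _
    (smooth_transition hM j i k) (sb k)) => //.
  by move=> u /[1!inE] -[ju ui]; rewrite /phi /= asboolT.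
- by exists C.
Qed.

End cutoffs.

Section fields.
Context (R : realType) (n : nat) (M : charted R n).
Hypothesis hM : smooth_manifold M.
Implicit Types (i j k : chart_index M) (x : M) (u : 'rV[R]_n).

Lemma smooth_vf0 : smooth_vf (fun x : M => 0 : tangent x).
Proof. by move=> i k; exact: Ck_cst. Qed.

Lemma smooth_vfD (X Y : vector_field M) :
  smooth_vf X -> smooth_vf Y -> smooth_vf (fun x => X x + Y x).
Proof. by move=> sX sY i k;
  exact: (CkD (open_chart_img hM i) (sX i k) (sY i k)). Qed.

Lemma smooth_vfZ (f : M -> R) (X : vector_field M) :
  smooth_fun f -> smooth_vf X -> smooth_vf (fun x => f x *: X x).
Proof. by move=> sf sX i k;
  exact: (CkZ (open_chart_img hM i) (sf i k) (sX i k)). Qed.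

Lemma smooth_vf_sum (I : Type) (r : seq I) (X : I -> vector_field M) :
  (forall a, smooth_vf (X a)) -> smooth_vf (fun x => \sum_(a <- r) X a x).
Proof.
move=> sX; elim: r => [|a r IH].
  rewrite (_ : (fun x => _) = fun x => 0); first exact: smooth_vf0.
  by apply: functional_extensionality_dep => x; rewrite big_nil.
rewrite (_ : (fun x => _) = fun x => X a x + \sum_(b <- r) X b x).
  exact: smooth_vfD.
by apply: functional_extensionality_dep => x; rewrite big_cons.
Qed.

Lemma smooth_funM (f g : M -> R) :
  smooth_fun f -> smooth_fun g -> smooth_fun (fun x => f x * g x).
Proof. by move=> sf sg i k;
  exact: (CkM (open_chart_img hM i) (sf i k) (sg i k)). Qed.

Lemma smooth_fun_differentiable (f : M -> R) x i : smooth_fun f ->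
  chart_dom i x ->
  differentiable (f \o chart_inv i : 'rV[R]_n -> R^o) (chart_map i x).
Proof. by move=> sf xi; apply: (sf i 1%N).1; exact: chart_imgP. Qed.

Section local_to_global.
Variables (i : chart_index M) (phi : M -> R) (N : set M).
Hypothesis hphi : cutoff i phi N.

Lemma cutoff_out x : ~ chart_dom i x -> phi x = 0.
Proof. by case: hphi => _ _ _ _ [C [_ Ci]] C0 xi; apply: C0 => /Ci. Qed.

Lemma smooth_cutoff_overlap j m :
  Ck_on m (overlap j i) (phi \o chart_inv j : 'rV[R]_n -> R^o).
Proof. by apply: sub_Ck (cutoff_smooth hphi j m) => u []. Qed.

(** Outside the domain of the chart coord_vec is a junk value, which the factor
    phi kills. *)
Lemma extend_vf (h : 'rV[R]_n -> 'rV[R]_n) : smooth_on (chart_img i) h ->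
  smooth_vf (fun x => phi x *: coord_vec x i (h (chart_map i x))).
Proof.
move=> sh j; apply: (glue_cutoff hM hphi) => [u _ ->|];
  first by rewrite scale0r.
move=> k; have oo := open_overlap hM j i.
have st := smooth_transition hM j i.
have tij u : overlap j i u ->
  overlap i j (transition j i u) by exact: overlap_transition.
have sht : smooth_on (overlap j i) (fun u => h (transition j i u)).
  move=> m; apply: (Ck_comp oo (open_chart_img hM i) _ (st m) (sh m)).
  by move=> u /tij[].
have := CkZ oo (smooth_cutoff_overlap j k)
  (smooth_diff_app oo (open_overlap hM i j) tij st (smooth_transition hM i j)
    sht k).
apply: eq_Ck => // u /[1!inE] uji; have [ju ui] := uji.
rewrite tangentZ (tangentP _ ui (chart_invP hM ju)); congr (_ *: _).
by rewrite coord_vecE.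
Qed.

Lemma extend_form (s : 'rV[R]_n -> 'rV[R]_n) : smooth_on (chart_img i) s ->
  smooth_form (fun x => phi x *: coord_covec x i (s (chart_map i x))).
Proof.
move=> sh j; apply: (glue_cutoff hM hphi) => [u _ ->|].
  by rewrite scale0r; apply/rowP => m; rewrite !mxE.
move=> k; have oo := open_overlap hM j i.
have st := smooth_transition hM j i.
have tij u : overlap j i u ->
  overlap i j (transition j i u) by exact: overlap_transition.
have sht : smooth_on (overlap j i) (fun u => s (transition j i u)).
  move=> m; apply: (Ck_comp oo (open_chart_img hM i) _ (st m) (sh m)).
  by move=> u /tij[].
have H : Ck_on k (overlap j i) (fun u => \row_m \sum_l
    s (transition j i u) 0 l * ('D_'e_m (transition j i) u) 0 l).
  apply: Ck_row => // m; apply: (@eq_Ck _ _ _ _ _ (fun u => \sum_l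
    s (transition j i u) 0 l * ('D_'e_m (transition j i) u) 0 l : R^o)) => //.
    by move=> u _; rewrite mxE.
  apply: Ck_sum => // l; apply: CkM => //.
    exact: Ck_coord oo (sht k).
  exact: Ck_coord oo ((st k.+1).2 _).
apply: eq_Ck (CkZ oo (smooth_cutoff_overlap j k) H) => // u /[1!inE] uji.
have [ju ui] := uji; rewrite /= cocoordZ; congr (_ *: _); apply/rowP => m.
rewrite mxE (cocoord_transition hM _ _ ui (chart_invP hM ju)).
apply: eq_bigr => l _; rewrite cocoord_covec//; congr (_ * _).
rewrite deriveE; last exact: (st 1%N).1.
by rewrite chart_invK.
Qed.

Lemma extend_fun (f : 'rV[R]_n -> R^o) : smooth_on (chart_img i) f ->
  smooth_fun (fun x => phi x * f (chart_map i x)).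
Proof.
move=> sf j; apply: (glue_cutoff hM hphi) => [u _ /=->|];
  first by rewrite mul0r.
move=> k; have oo := open_overlap hM j i.
apply: (CkM oo (smooth_cutoff_overlap j k)).
apply: (Ck_comp_scalar oo (open_chart_img hM i) _
  (smooth_transition hM j i k) (sf k)).
by move=> u /(overlap_transition hM)[].
Qed.

End local_to_global.
End fields.

(** * Christoffel symbols *)

Section connection.
Context (R : realType) (n : nat) (M : charted R n).
Hypothesis hM : smooth_manifold M.
Variable D : vector_field M -> vector_field M -> vector_field M.
Hypothesis hD : linear_connection D.
Implicit Types (X Y : vector_field M) (f : M -> R) (i : chart_index M).
Implicit Types (x y : M).

Let s0 : smooth_vf (fun x : M => 0 : tangent x) := @smooth_vf0 R n M.

(* The type of D X Y x depends on x, which blocks congruence tactics. *)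
Let eql X X' Y x : (forall z, X z = X' z) -> D X Y x = D X' Y x.
Proof. by move=> e; rewrite (functional_extensionality_dep e). Qed.

Let eqr X Y Y' x : (forall z, Y z = Y' z) -> D X Y x = D X Y' x.
Proof. by move=> e; rewrite (functional_extensionality_dep e). Qed.

Lemma smooth_fun_cst (c : R) : smooth_fun (fun _ : M => c).
Proof. by move=> i k; exact: Ck_cst. Qed.

Lemma connDl X X' Y x : smooth_vf X -> smooth_vf X' -> smooth_vf Y ->
  D (fun y => X y + X' y) Y x = D X Y x + D X' Y x.
Proof.
move=> sX sX' sY; case: hD => _ Dl _ _.
have := Dl _ _ _ _ (smooth_fun_cst 1) sX sX' sY x; rewrite scale1r => <-.
by apply: eql => z; rewrite scale1r.
Qed.

Lemma conn0l Y x : smooth_vf Y -> D (fun=> 0) Y x = 0.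
Proof.
move=> sY; apply: (@addrI _ (D (fun=> 0) Y x)); rewrite addr0 -connDl//.
by apply: eql => z; rewrite addr0.
Qed.

Lemma connZl f X Y x : smooth_fun f -> smooth_vf X -> smooth_vf Y ->
  D (fun y => f y *: X y) Y x = f x *: D X Y x.
Proof.
move=> sf sX sY; case: hD => _ Dl _ _.
have := Dl _ _ _ _ sf sX s0 sY x; rewrite conn0l// addr0 => <-.
by apply: eql => z; rewrite addr0.
Qed.

Lemma conn0r X x : smooth_vf X -> D X (fun=> 0) x = 0.
Proof.
move=> sX; case: hD => _ _ Dr _.
apply: (@addrI _ (D X (fun=> 0) x)); rewrite addr0 -Dr//.
by apply: eqr => z; rewrite addr0.
Qed.

Lemma conn_suml (I : Type) (r : seq I) (f : I -> M -> R)
    (X : I -> vector_field M) Y x :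
  (forall a, smooth_fun (f a)) -> (forall a, smooth_vf (X a)) -> smooth_vf Y ->
  D (fun y => \sum_(a <- r) f a y *: X a y) Y x =
  \sum_(a <- r) f a x *: D (X a) Y x.
Proof.
move=> sf sX sY; elim: r => [|a r IH].
  rewrite big_nil -[RHS](conn0l x sY); apply: eql => z.
  by rewrite big_nil.
rewrite big_cons -IH -connZl// -connDl//.
- by apply: eql => z; rewrite big_cons.
- exact: smooth_vfZ.
- by apply: smooth_vf_sum => // b; exact: smooth_vfZ.
Qed.

Lemma conn_sumr (I : Type) (r : seq I) (f : I -> M -> R)
    (Y : I -> vector_field M) X x :
  (forall a, smooth_fun (f a)) -> (forall a, smooth_vf (Y a)) -> smooth_vf X ->
  D X (fun y => \sum_(a <- r) f a y *: Y a y) x =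
  \sum_(a <- r) (f a x *: D X (Y a) x + deriv_along (f a) (X x) *: Y a x).
Proof.
move=> sf sY sX; case: hD => _ _ Dr DZ; elim: r => [|a r IH].
  rewrite big_nil -[RHS](conn0r x sX); apply: eqr => z.
  by rewrite big_nil.
rewrite big_cons -IH -DZ// -Dr//.
- by apply: eqr => z; rewrite big_cons.
- exact: smooth_vfZ.
- by apply: smooth_vf_sum => // b; exact: smooth_vfZ.
Qed.

(** G j k u is the vector of components of D_j d_k at the point with coordinates
    u.  The formula is only required on N, where the symbols come from global
    fields that agree with the coordinate frame. *)
Record christoffel i (N : set M) (G : 'I_n -> 'I_n -> 'rV[R]_n -> 'rV[R]_n) :
    Prop := Christoffel {
  chr_open : open N;
  chr_sub : N `<=` chart_dom i;
  chr_smooth : forall j k, smooth_on (chart_img i) (G j k);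
  chrE : forall X Y, smooth_vf X -> smooth_vf Y -> forall y, N y ->
    D X Y y i = 'd (fun u => Y (chart_inv i u) i) (chart_map i y) (X y i) +
      \sum_j \sum_k (X y i 0 j * Y y i 0 k) *: G j k (chart_map i y)
}.

Section frame.
Variables (i : chart_index M) (phi : M -> R) (N : set M).
Hypothesis hphi : cutoff i phi N.

Let E (k : 'I_n) : vector_field M := fun x => phi x *: coord_vec x i 'e_k.

Let sE k : smooth_vf (E k).
Proof. by apply: (extend_vf hM hphi (h := fun=> 'e_k)) => m; exact: Ck_cst. Qed.

(* The component of X, multiplied by phi; it is written through the chart so as
   to be a global function. *)
Let comp (X : vector_field M) (k : 'I_n) (x : M) : R :=
  phi x * X (chart_inv i (chart_map i x)) i 0 k.

Let smooth_comp X k : smooth_vf X -> smooth_fun (comp X k).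
Proof.
move=> sX; apply: (extend_fun hM hphi (f := fun u => X (chart_inv i u) i 0 k)).
by move=> m; exact: Ck_coord (open_chart_img hM i) (sX i m).
Qed.

Let compE X k x : N x -> comp X k x = X x i 0 k.
Proof.
move=> Nx; have xi := cutoff_sub hphi Nx.
by rewrite /comp chart_mapK// (cutoff1 hphi)// mul1r.
Qed.

(* One factor phi globalizes the components and the other one the frame. *)
Let phi2_expand X :
  (fun x => (phi x * phi x) *: X x) = (fun x => \sum_k comp X k x *: E k x).
Proof.
apply: functional_extensionality_dep => x.
have [xi|xi] := pselect (chart_dom i x); last first.
  rewrite (cutoff_out hphi xi) mulr0 scale0r big1// => k _.
  by rewrite /comp (cutoff_out hphi xi) mul0r scale0r.
rewrite {1}(coord_vec_expand hM (X x) xi) scaler_sumr; apply: eq_bigr => k _.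
by rewrite /comp chart_mapK// /E !scalerA mulrAC.
Qed.

Let sphi2 : smooth_fun (fun x => phi x * phi x).
Proof. by apply: smooth_funM => //; exact: cutoff_smooth hphi. Qed.

Let deriv_near f g x (v : tangent x) : smooth_fun f -> N x ->
  (forall y, N y -> f y = g y) ->
  deriv_along f v =
    'd (g \o chart_inv i : 'rV[R]_n -> R^o) (chart_map i x) (v i).
Proof.
move=> sf Nx fg; have xi := cutoff_sub hphi Nx.
have df := smooth_fun_differentiable sf xi.
have EE : {near chart_map i x, (f \o chart_inv i : 'rV[R]_n -> R^o) =1
    (g \o chart_inv i : 'rV[R]_n -> R^o)}.
  have := near_chart hM (cutoff_open hphi) xi Nx.
  by apply: filterS => u [_ Nu]; exact: fg.
have [_ e] := near_eq_diff EE df.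
by rewrite (deriv_alongE hM _ xi df); exact: (congr1 (@^~ (v i)) (esym e)).
Qed.

(** Tensoriality: phi^2 X equals X at x and is a combination of the global
    fields E k with smooth coefficients. *)
Lemma conn_locall X Y x : smooth_vf X -> smooth_vf Y -> N x ->
  D X Y x = \sum_k X x i 0 k *: D (E k) Y x.
Proof.
move=> sX sY Nx; have : D (fun x => (phi x * phi x) *: X x) Y x = D X Y x.
  by rewrite connZl// (cutoff1 hphi Nx) mulr1 scale1r.
rewrite phi2_expand conn_suml// => [<-|k]; last exact: smooth_comp.
by apply: eq_bigr => k _; rewrite compE.
Qed.

(** Multiplication of Y by phi^2 is harmless: the Leibniz term contains the
    derivative of phi^2, which is 0 near x. *)
Lemma conn_localr X Y x : smooth_vf X -> smooth_vf Y -> N x ->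
  D X Y x = \sum_k (Y x i 0 k *: D X (E k) x +
    ('d (fun u => Y (chart_inv i u) i) (chart_map i x) (X x i)) 0 k *:
      coord_vec x i 'e_k).
Proof.
move=> sX sY Nx; have xi := cutoff_sub hphi Nx.
have : D X (fun x => (phi x * phi x) *: Y x) x = D X Y x.
  case: hD => _ _ _ DZ; rewrite DZ// (cutoff1 hphi Nx) mulr1 scale1r.
  rewrite (deriv_near (g := fun=> 1)) => //; last first.
    by move=> y Ny; rewrite (cutoff1 hphi Ny) mulr1.
  have -> :
      'd ((fun=> 1) \o chart_inv i : _ -> R^o) (chart_map i x) (X x i) = 0.
    exact: (congr1 (@^~ (X x i)) (diff_cst (1 : R^o) (chart_map i x))).
  by rewrite scale0r addr0.
rewrite phi2_expand conn_sumr// => [<-|k]; last exact: smooth_comp.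
apply: eq_bigr => k _; rewrite compE//; congr (_ + _ *: _); last first.
  by rewrite /E (cutoff1 hphi Nx) scale1r.
rewrite (deriv_near (g := fun y => Y y i 0 k))//; first last.
- by move=> y Ny; exact: compE.
- exact: smooth_comp.
have dY : differentiable (fun u => Y (chart_inv i u) i) (chart_map i x).
  by apply: (sY i 1%N).1; exact: chart_imgP.
exact: (diff_coord (X x i) k dY).2.
Qed.

Lemma christoffel_cutoff :
  christoffel i N (fun j k u => D (E j) (E k) (chart_inv i u) i).
Proof.
have sD j k : smooth_vf (D (E j) (E k)) by case: hD => + _ _ _; apply.
split; [exact: cutoff_open hphi|exact: cutoff_sub hphi| |].
  by move=> j k; exact: sD.
move=> X Y sX sY y Ny; have yi := cutoff_sub hphi Ny.
rewrite conn_localr// big_split tangentD !tangent_sum addrC; congr (_ + _).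
  rewrite [RHS]rV_expand; apply: eq_bigr => k _.
  by rewrite tangentZ coord_vecE.
rewrite exchange_big; apply: eq_bigr => k _.
rewrite [LHS]tangentZ conn_locall// tangent_sum scaler_sumr;
  apply: eq_bigr => j _.
by rewrite tangentZ scalerA mulrC chart_mapK.
Qed.

End frame.

Lemma christoffel_exists i x : chart_dom i x ->
  exists N G, christoffel i N G /\ N x.
Proof.
move=> xi; have [phi [N [hphi Nx]]] := cutoff_exists hM xi.
by exists N; eexists; split; [exact: (christoffel_cutoff hphi)|].
Qed.

End connection.

(** * The cotangent bundle as a smooth manifold *)

Section bundle.
Context (R : realType) (n : nat) (M : charted R n).
Hypothesis hM : smooth_manifold M.
Local Notation TsM := (cotangent_manifold M).
Implicit Types (i j k : chart_index M) (a b : TsM) (u : 'rV[R]_(n + n)).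

Lemma bundle_ext i a b : bundle_dom i a -> bundle_dom i b ->
  bundle_map i a = bundle_map i b -> a = b.
Proof.
case: a b => [x a] [y b] xi yi /eq_row_mx[/= exy].
have {}exy : x = y by rewrite -[x](chart_mapK hM xi) exy chart_mapK.
by case: y / exy in b yi * => ab; rewrite (cocoord_ext hM xi ab).
Qed.

Lemma bundle_mapK i u : bundle_img i u -> bundle_map i (bundle_inv i u) = u.
Proof.
move=> iu; rewrite /bundle_map /= chart_invK// cocoord_covec ?hsubmxK//.
exact: chart_invP.
Qed.

Lemma bundle_img_map i a : bundle_dom i a -> bundle_img i (bundle_map i a).
Proof. by move=> ai; rewrite /bundle_img /= row_mxKl; exact: chart_imgP. Qed.

Lemma bundle_dom_inv i u : bundle_img i u -> bundle_dom i (bundle_inv i u).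
Proof. exact: chart_invP. Qed.

Lemma bundle_invK i a : bundle_dom i a -> bundle_inv i (bundle_map i a) = a.
Proof.
move=> ai; have ui := bundle_img_map ai.
by apply: (@bundle_ext i) => //; [exact: bundle_dom_inv|exact: bundle_mapK].
Qed.

Lemma bundle_imgE i : chart_img (i : chart_index TsM) = bundle_img i.
Proof.
rewrite eqEsubset; split => [_ [a ai <-]|u iu]; first exact: bundle_img_map.
by exists (bundle_inv i u); [exact: bundle_dom_inv|exact: bundle_mapK].
Qed.

Lemma open_lsubmx_preim (O : set 'rV[R]_n) : open O ->
  open (lsubmx @^-1` O : set 'rV[R]_(n + n)).
Proof. by apply: open_comp => u _; exact: continuous_lsubmx. Qed.

Lemma open_bundle_img i : open (bundle_img i).
Proof. exact: open_lsubmx_preim (open_chart_img hM i). Qed.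
Arguments open_bundle_img : clear implicits.

(** The topology of the bundle is coinduced by the local parametrizations, whose
    domains are open, so the subspace topologies in its definition can be
    dropped. *)
Lemma bundle_openP (O : set TsM) :
  (forall i, open (bundle_img i `&` bundle_inv i @^-1` O)) -> open O.
Proof.
move=> H; suff : bundle_open O by [].
by move=> i; rewrite -open_setSI//; exact: open_bundle_img.
Qed.

Lemma bundle_open_preim (O : set TsM) i :
  open O -> open (bundle_img i `&` bundle_inv i @^-1` O).
Proof.
move=> oO; have {}oO : bundle_open O by [].
by rewrite open_setSI; [exact: oO|exact: open_bundle_img].
Qed.
Arguments bundle_open_preim : clear implicits.

Definition bundle_overlap i j : set 'rV[R]_(n + n) := lsubmx @^-1` overlap i j.

Lemma open_bundle_overlap i j : open (bundle_overlap i j).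
Proof. exact: open_lsubmx_preim (open_overlap hM i j). Qed.
Arguments open_bundle_overlap : clear implicits.

Lemma open_bundle_dom i : open (bundle_dom i : set TsM).
Proof.
by apply: bundle_openP => j; exact: open_bundle_overlap.
Qed.
Arguments open_bundle_dom : clear implicits.

(** The first half of the new coordinates is the transition map of the base;
    the second half is linear in the old fibre coordinates, with first
    derivatives of the inverse transition map as coefficients. *)
Lemma smooth_bundle_transition i j :
  smooth_on (bundle_overlap i j) (bundle_map j \o bundle_inv i).
Proof.
move=> k; have oB := open_bundle_overlap i j; have oij := open_overlap hM i j.
have lP u : bundle_overlap i j u -> overlap i j (lsubmx u) by [].
have st := Ck_comp oB oij lP (Ck_lsubmx _ oB) (smooth_transition hM i j k).
have oji := open_overlap hM j i.
have tP u : bundle_overlap i j u -> overlap j i (transition i j (lsubmx u)).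
  by move=> /lP; exact: overlap_transition.
have H : Ck_on k (bundle_overlap i j) (fun u =>
    row_mx (transition i j (lsubmx u))
    (\row_m \sum_l rsubmx u 0 l *
      ('D_'e_m (transition j i) (transition i j (lsubmx u))) 0 l)).
  apply: (Ck_row_mx oB st); apply: Ck_row => // m.
  apply: (@eq_Ck _ _ _ _ _ (fun u => \sum_l rsubmx u 0 l *
      ('D_'e_m (transition j i) (transition i j (lsubmx u))) 0 l : R^o)) => //.
    by move=> u _; rewrite mxE.
  apply: Ck_sum => // l; apply: CkM => //.
    exact: Ck_coord oB (Ck_rsubmx _ oB).
  exact: (Ck_comp_scalar oB oji tP st
    (Ck_coord l oji ((smooth_transition hM j i k.+1).2 _))).
apply: eq_Ck H => // u /[1!inE] uij; have [iu ju] := lP _ uij.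
rewrite /= /bundle_map /=; congr row_mx; apply/rowP => m.
rewrite mxE (cocoord_transition hM _ _ (chart_invP hM iu) ju).
apply: eq_bigr => l _; rewrite cocoord_covec ?deriveE//.
  exact: ((smooth_transition hM j i 1%N).1 _ (tP _ uij)).
exact: chart_invP.
Qed.

Lemma continuous_bundle_map i a : bundle_dom i a ->
  {for a, continuous (bundle_map i : TsM -> _)}.
Proof.
move=> ai A nA; pose O : set TsM :=
  bundle_dom i `&` bundle_map i @^-1` (interior A).
(* O is open by the smoothness, in particular the continuity, of the
   transition maps of the bundle. *)
suff oO : open O.
  have : nbhs a O by apply: open_near.
  by apply: filterS => b [_]; exact: interior_subset.
apply: bundle_openP => j.
have -> : bundle_img j `&` bundle_inv j @^-1` O =
    bundle_overlap j i `&` (bundle_map i \o bundle_inv j) @^-1` (interior A).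
  by rewrite eqEsubset; split=> u; rewrite /O /=; [move=> [? []]|move=> [[]]].
rewrite openE => u [uji Au]; apply: filterI.
  exact: open_near (open_bundle_overlap j i) uji.
have cu : {for u, continuous (bundle_map i \o bundle_inv j)}.
  exact: (smooth_bundle_transition j i 0%N u uji).
apply: cu; have oA : open (interior A) by exact: open_interior.
exact: open_near oA Au.
Qed.

Lemma continuous_bundle_inv i u : bundle_img i u ->
  {for u, continuous (bundle_inv i : _ -> TsM)}.
Proof.
move=> iu A; rewrite nbhsE => -[] O [oO Ou] OA.
have : nbhs u (bundle_img i `&` bundle_inv i @^-1` O).
  exact: (open_near (bundle_open_preim O i oO) (conj iu Ou)).
by apply: filterS => w [_ /OA].
Qed.

Lemma continuous_foot : continuous (fun a : TsM => foot a).
Proof.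
move=> a A; rewrite nbhsE => -[] O [oO Oa] OA.
have oP : open [set b : TsM | O (foot b)].
  apply: bundle_openP => j.
  exact: open_lsubmx_preim (open_chart_preim hM j O oO).
have : nbhs a [set b : TsM | O (foot b)] by exact: open_near oP Oa.
by apply: filterS => b /OA.
Qed.

(** Points that cannot be separated have the same foot since M is Hausdorff,
    and then the same coordinates in one chart. *)
Lemma bundle_hausdorff : hausdorff_space TsM.
Proof.
move=> a b ab; have eab : foot a = foot b.
  have [hM1 _ _ _ _] := hM; apply: hM1.
  by apply: (cluster_image (f := fun c : TsM => foot c)) ab;
    exact: continuous_foot.
have [i ai] := chart_cover hM (foot a).
have bi : bundle_dom i b by rewrite /bundle_dom /= -eab.
apply: (bundle_ext (i := i)) => //; apply: norm_hausdorff.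
by apply: cluster_image ab; exact: continuous_bundle_map.
Qed.

Lemma rV_rat_dense (v : 'rV[R]_n) (e : R) : 0 < e ->
  exists q : 'rV[rat]_n, `|v - map_mx ratr q| <= e.
Proof.
move=> e0; have H l : exists q : rat, `|v 0 l - ratr q| <= e.
  have [|q] := @rat_in_itvoo R (v 0 l - e) (v 0 l).
    by rewrite ltrBlDr ltrDl.
  rewrite in_itv /= => /andP[q1 q2]; exists q.
  rewrite ger0_norm ?subr_ge0 ?(ltW q2)//.
  by rewrite lerBlDl -lerBlDr ltW.
exists (\row_l projT1 (cid (H l))); apply: rV_norm_le; first exact: ltW.
by move=> l; rewrite !mxE; case: cid.
Qed.

(** A basic set: the foot lies in A and W, and the fibre coordinates lie in a
    rational ball.  The set A is there only to choose a chart whose domain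
    contains it: the charts themselves may be uncountably many. *)
Definition bundle_cell (c : set M * set M * 'rV[rat]_n * nat) : set TsM :=
  let: (A, W, q, m) := c in
  if pselect (exists i, A `<=` chart_dom i) is left h then
    [set a | [/\ A (foot a), W (foot a) &
      `|cocoord (projT1 (cid h)) (covector a) - map_mx ratr q| < m.+1%:R^-1]]
  else set0.

(** Around a given point, A is chosen inside some chart domain; W and the
    rational ball are then adapted to the chart that bundle_cell picks for A,
    which need not be the one A was chosen from. *)
Lemma bundle_second_countable : @second_countable TsM.
Proof.
have [_ [B cB [oB bB]] _ _ _] := hM.
exists (bundle_cell @` (B `*` B `*` setT `*` setT)).
  apply: sub_countable (card_image_le _ _) _.
  by do 3!apply: countableX => //; exact: countableP.
split.
  move=> _ [[[[A W] q] m] [[[BA BW] _] _] <-] /=.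
  case: pselect => [h|_]; last exact: open0.
  case: cid => i Ai /=; rewrite openE => a [Aa Wa ca].
  have nA : nbhs (foot a) A by apply: open_near => //; exact: oB.
  have nW : nbhs (foot a) W by apply: open_near => //; exact: oB.
  have {}nA : nbhs a [set b : TsM | A (foot b)] by exact: continuous_foot nA.
  have {}nW : nbhs a [set b : TsM | W (foot b)] by exact: continuous_foot nW.
  have ai : bundle_dom i a by exact: Ai.
  have cc : {for a, continuous (fun b : TsM => cocoord i (covector b))}.
    rewrite (_ : (fun b : TsM => _) = rsubmx \o bundle_map i).
      apply: continuous_comp; first exact: continuous_bundle_map.
      exact: continuous_rsubmx.
    by apply/funext => b; rewrite /= row_mxKr.
  pose c : 'rV[R]_n := map_mx ratr q.
  have nc : nbhs a [set b : TsM | `|cocoord i (covector b) - c| < m.+1%:R^-1].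
    apply: (cc [set v | `|v - c| < m.+1%:R^-1]).
    exact: (open_near (@open_norm_lt R n c _) ca).
  by apply: filterS3 nA nW nc => b /= Ab Wb nb; split.
move=> a O nO; have [i ai] := chart_cover hM (foot a).
have [A [BA Aa] Ai] :=
  bB (foot a) (chart_dom i) (open_near (open_chart_dom hM i) ai).
have h : exists i, A `<=` chart_dom i by exists i.
pose i' := projT1 (cid h).
have Ai' : A `<=` chart_dom i' by rewrite /i'; case: cid.
have ai' : bundle_dom i' a by exact: Ai'.
have : nbhs (bundle_map i' a) (bundle_inv i' @^-1` O).
  apply: continuous_bundle_inv; first exact: bundle_img_map.
  by rewrite bundle_invK.
move=> /nbhs_normP[e /= e0 eO].
have e20 : 0 < e / 2 by rewrite divr_gt0.
have [W [BW Wa] We] : filter_from [set U | B U /\ U (foot a)] id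
    [set y | chart_dom i' y /\ `|chart_map i' y - chart_map i'
      (foot a)| < e / 2].
  apply: bB; apply: filterI; first exact: open_near (open_chart_dom hM i') ai'.
  apply: (continuous_chart_map hM ai'
    (t := [set v | `|v - chart_map i' (foot a)| < e / 2])).
  apply: (open_near (@open_norm_lt R n _ _)).
  by rewrite /= subrr normr0.
(* 1/(m+1) < e/4; the bounds below add up to e/2, which leaves room for the
   strict inequality. *)
pose m := Num.truncn (4 / e).
have me : m.+1%:R^-1 < e / 4.
  rewrite -[e / 4]invrK ltf_pV2 ?posrE ?invr_gt0 ?divr_gt0// invf_div.
  exact: truncnS_gt.
have m0 : 0 < m.+1%:R^-1 / 2 :> R by rewrite divr_gt0// invr_gt0.
have [q qa] := rV_rat_dense (cocoord i' (covector a)) m0.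
exists (bundle_cell (A, W, q, m)).
  split; first by exists (A, W, q, m).
  rewrite /bundle_cell; case: pselect => // h'; rewrite (Prop_irrelevance h' h).
  split=> //; apply: le_lt_trans qa _.
  by rewrite ltr_pdivrMr// ltr_pMr ?ltr1n// invr_gt0.
rewrite /bundle_cell; case: pselect => // h'; rewrite (Prop_irrelevance h' h).
move=> b [Ab Wb bq]; have bi' : bundle_dom i' b by exact: Ai'.
rewrite -(bundle_invK bi'); apply: eO; rewrite /= distrC.
have [_ /ltW Wab] := We _ Wb.
apply: (@le_lt_trans _ _ (e / 2)); last first.
  by rewrite ltr_pdivrMr// ltr_pMr// ltr1n.
rewrite /bundle_map opp_row_mx add_row_mx; apply: rV_norm_le; first exact: ltW.
move=> l; case: (split_ordP l) => l' ->.
  by rewrite row_mxEl; apply: le_trans Wab; exact: rV_coord_le.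
rewrite row_mxEr; apply: le_trans (rV_coord_le _ _) _.
rewrite -(subrKA (map_mx ratr q)); apply: le_trans (ler_normD _ _) _.
rewrite (_ : e / 2 = e / 4 + e / 4).
  apply: lerD; first exact: ltW (lt_trans bq me).
  rewrite distrC; apply: le_trans qa _; apply: ltW; apply: lt_trans me.
  by rewrite ltr_pdivrMr// ltr_pMr ?ltr1n// invr_gt0.
by field.
Qed.

Lemma bundle_manifold : smooth_manifold TsM.
Proof.
split.
- exact: bundle_hausdorff.
- exact: bundle_second_countable.
- by move=> a; have [i ai] := chart_cover hM (foot a); exists i.
- move=> i; split; rewrite ?bundle_imgE.
  + exact: open_bundle_dom.
  + exact: open_bundle_img.
  + exact: bundle_invK.
  + exact: continuous_bundle_map.
  + exact: continuous_bundle_inv.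
- move=> i j k.
  apply: sub_Ck (smooth_bundle_transition i j k) => _ [a [ai aj] <-].
  by rewrite /bundle_overlap /= row_mxKl; exact: overlapP.
Qed.

End bundle.
Arguments open_bundle_img {R n M} hM i.

(** * The dual connection and the horizontal and vertical lifts *)

Section parallel.
Context (R : realType) (n : nat) (M : charted R n).
Hypothesis hM : smooth_manifold M.
Variable D : vector_field M -> vector_field M -> vector_field M.
Hypothesis hD : linear_connection D.
Implicit Types (i : chart_index M).

(** The derivative in the direction X of the components of a 1-form that is
    parallel in that direction and has components b at u. *)
Definition transport (G : 'I_n -> 'I_n -> 'rV[R]_n -> 'rV[R]_n)
    (u X b : 'rV[R]_n) : 'rV[R]_n :=
  \row_k \sum_j X 0 j * (\sum_l b 0 l * G j k u 0 l).

Lemma transport_linear G u b : linear (fun X => transport G u X b).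
Proof.
move=> c X Y; apply/rowP => k; rewrite !mxE mulr_sumr -big_split.
by apply: eq_bigr => j _; rewrite !mxE mulrDl mulrA.
Qed.

(** The coordinate form of the definition of the dual connection: the terms
    with dY cancel, and what remains is linear in Y. *)
Lemma transport_duality G u (ds X c Y dY : 'rV[R]_n) :
  \sum_k (ds - transport G u X c) 0 k * Y 0 k =
  \sum_k (ds 0 k * Y 0 k + c 0 k * dY 0 k) -
  \sum_k c 0 k * (dY + \sum_j \sum_l (X 0 j * Y 0 l) *: G j l u) 0 k.
Proof.
pose S := \sum_j \sum_l (X 0 j * Y 0 l) *: G j l u.
rewrite -/S -sumrB [RHS](eq_bigr (fun k => ds 0 k * Y 0 k - c 0 k * S 0 k)).
  2: by move=> k _; rewrite [(dY + S) 0 k]mxE; ring.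
rewrite [LHS](eq_bigr
  (fun k => ds 0 k * Y 0 k - transport G u X c 0 k * Y 0 k)).
  2: by move=> k _; rewrite [(ds - _) 0 k]mxE [(- transport _ _ _ _) 0 k]mxE
    mulrBl.
rewrite !sumrB; congr (_ - _).
have SE k : S 0 k = \sum_j \sum_l X 0 j * Y 0 l * G j l u 0 k.
  rewrite /S summxE; apply: eq_bigr => j _.
  by rewrite summxE; apply: eq_bigr => l _; rewrite mxE.
under [RHS]eq_bigr do rewrite SE mulr_sumr.
under [LHS]eq_bigr do rewrite mxE mulr_suml.
rewrite exchange_big [RHS]exchange_big /=; apply: eq_bigr => j _.
under [RHS]eq_bigr do rewrite mulr_sumr.
rewrite [RHS]exchange_big /=; apply: eq_bigr => k _.
by rewrite mulr_sumr mulr_suml; apply: eq_bigr => l _; ring.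
Qed.

Lemma pairing_derivative i x (s : one_form M) (Y : vector_field M)
    (v : tangent x) :
  smooth_form s -> smooth_vf Y -> chart_dom i x ->
  deriv_along (fun y => s y (Y y)) v =
  \sum_k (('d (fun u => cocoord i (s (chart_inv i u))) (chart_map i x)
    (v i)) 0 k
            * Y x i 0 k +
          cocoord i (s x) 0 k *
          ('d (fun u => Y (chart_inv i u) i) (chart_map i x) (v i)) 0 k).
Proof.
move=> ss sY xi; set u0 := chart_map i x.
have iu0 : chart_img i u0 by exact: chart_imgP.
have [d e] := diff_dot (v i) ((ss i 1%N).1 _ iu0) ((sY i 1%N).1 _ iu0).
have E : {near u0, (fun u => \sum_k cocoord i (s (chart_inv i u)) 0 k *
    Y (chart_inv i u) i 0 k : R^o) =1
    ((fun y => s y (Y y)) \o chart_inv i : 'rV[R]_n -> R^o)}.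
  near=> u; have ui : chart_img i u.
    by near: u; exact: open_near (open_chart_img hM i) iu0.
  by rewrite /= (cotangentE hM _ _ (chart_invP hM ui)).
have [d' e'] := near_eq_diff E d.
rewrite (deriv_alongE hM v xi d').
apply: etrans (congr1 (@^~ (v i)) e') _; apply: etrans e _.
by rewrite chart_mapK.
Unshelve. all: by end_near. Qed.

Section in_chart.
Variables (i : chart_index M) (N : set M).
Variable G : 'I_n -> 'I_n -> 'rV[R]_n -> 'rV[R]_n.
Hypothesis hG : christoffel D i N G.

Lemma exists_vf x (v : tangent x) : chart_dom i x ->
  exists X : vector_field M, smooth_vf X /\ X x = v.
Proof.
move=> xi; have [phi [N' [hphi N'x]]] := cutoff_exists hM xi.
exists (fun y => phi y *: coord_vec y i (v i)); split.
  by apply: (extend_vf hM hphi (h := fun=> v i)) => k; exact: Ck_cst.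
by rewrite (cutoff1 hphi N'x) scale1r coord_vecK.
Qed.

(** The value is characterized by its pairing with smooth fields; it is unique
    because every tangent vector extends to a smooth field. *)
Lemma dual_connE X s x : smooth_vf X -> smooth_form s -> N x ->
  dual_connection D X s x = coord_covec x i
    ('d (fun u => cocoord i (s (chart_inv i u))) (chart_map i x) (X x i) -
     transport G (chart_map i x) (X x i) (cocoord i (s x))).
Proof.
move=> sX ss Nx; have xi := chr_sub hG Nx.
set b := coord_covec _ _ _.
have bE Y : smooth_vf Y ->
    b (Y x) = deriv_along (fun y => s y (Y y)) (X x) - s x (D X Y x).
  move=> sY; rewrite (pairing_derivative _ ss sY xi) (cotangentE hM _ _ xi).
  rewrite cocoord_covec// (cotangentE hM (s x) _ xi) (chrE hG sX sY Nx).
  exact: transport_duality.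
apply: the_unique => // b' b'E; apply: cotangent_ext => v.
by have [Y [sY <-]] := exists_vf v xi; rewrite bE// b'E.
Qed.

Lemma dual_conn0 X s x : smooth_vf X -> smooth_form s -> N x ->
  dual_connection D X s x = 0 <->
  'd (fun u => cocoord i (s (chart_inv i u))) (chart_map i x) (X x i) =
     transport G (chart_map i x) (X x i) (cocoord i (s x)).
Proof.
move=> sX ss Nx; have xi := chr_sub hG Nx; rewrite dual_connE//.
have c0 : cocoord i (0 : cotangent x) = 0 by apply/rowP => k; rewrite !mxE.
split=> [/(congr1 (cocoord i))|->].
  by rewrite cocoord_covec// c0 => /eqP; rewrite subr_eq0 => /eqP.
by rewrite subrr; apply: (cocoord_ext hM xi); rewrite cocoord_covec// c0.
Qed.

Local Notation TsM := (cotangent_manifold M).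
Let hN : smooth_manifold TsM := bundle_manifold hM.

Lemma section_rep_diff (s : one_form M) x (v : tangent x) : smooth_form s ->
  chart_dom i x ->
  let F := bundle_map i \o section_of s \o chart_inv i in
  differentiable F (chart_map i x) /\
  'd F (chart_map i x) (v i) = row_mx (v i)
    ('d (fun u => cocoord i (s (chart_inv i u))) (chart_map i x) (v i)).
Proof.
move=> ss xi F; set u0 := chart_map i x.
have iu0 : chart_img i u0 by exact: chart_imgP.
have oi := open_chart_img hM i.
pose F' (u : 'rV[R]_n) := row_mx u (cocoord i (s (chart_inv i u))).
have dF' : differentiable F' u0.
  exact: (Ck_row_mx oi (Ck_id 1%N oi) (ss i 1%N)).1.
have ds := (ss i 1%N).1 _ iu0.
have E : {near u0, F' =1 F}.
  near=> u; have iu : chart_img i u by near: u; exact: open_near oi iu0.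
  by rewrite /F' /F /= /bundle_map /= chart_invK.
have [dF e] := near_eq_diff E dF'; split; first exact: dF.
apply: etrans (congr1 (@^~ (v i)) e) _; apply/rowP => j.
apply: etrans (esym (diff_coord (v i) j dF').2) _.
case: (split_ordP j) => l ->.
  rewrite row_mxEl.
  have -> : (fun u => F' u 0 (lshift n l)) = (fun u : 'rV[R]_n => u 0 l).
    by apply/funext => u; rewrite /F' row_mxEl.
  have [did eid] := diff_id_at u0 (v i).
  by apply: etrans (diff_coord (v i) l did).2 _;
    exact: (congr1 (fun w : 'rV_n => w 0 l) eid).
rewrite row_mxEr.
have -> : (fun u => F' u 0 (rshift n l)) =
    (fun u : 'rV[R]_n => cocoord i (s (chart_inv i u)) 0 l).
  by apply/funext => u; rewrite /F' row_mxEr.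
exact: (diff_coord (v i) l ds).2.
Unshelve. all: by end_near. Qed.

Lemma covector_eta (a : cotangent_bundle M) : Covector (covector a) = a.
Proof. by case: a. Qed.

Section at_covector.
Variable a : TsM.
Hypothesis Na : N (bundle_proj a).
Let x : M := bundle_proj a.
Let xi : chart_dom i x := chr_sub hG Na.
Let ai : chart_dom (i : chart_index TsM) a := xi.
Let u0 := chart_map i x.
Let al := cocoord i (covector a).

Lemma pushforward_projE (w : tangent a) (X : tangent (bundle_proj a)) :
  Defs.pushforward (@bundle_proj R n M) w X <-> X i = lsubmx (w i).
Proof.
have p0 : bundle_img i (bundle_map i a) by exact: bundle_img_map.
have E : {near bundle_map i a, (lsubmx : 'rV[R]_(n + n) -> 'rV[R]_n) =1
    chart_map i \o @bundle_proj R n M \o bundle_inv i}.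
  near=> u; have iu : bundle_img i u.
    by near: u; exact: open_near (open_bundle_img hM i) p0.
  by rewrite /= chart_invK.
have dl : differentiable (lsubmx : 'rV[R]_(n + n) -> 'rV[R]_n) (bundle_map i a).
  exact: differentiable_lsubmx.
have [d e] := near_eq_diff E dl.
have e1 : 'd (chart_map i \o @bundle_proj R n M \o bundle_inv i)
    (bundle_map i a) (w i) = lsubmx (w i).
  apply: etrans (congr1 (@^~ (w i)) e) _.
  exact: (congr1 (@^~ (w i)) (diff_lin _ (@continuous_lsubmx _ _ _ _))).
split=> [[_ /(_ i i ai xi) H]|Xi]; first exact: etrans H e1.
have nP : \forall u \near bundle_map i a,
    chart_dom i (@bundle_proj R n M (bundle_inv i u)).
  near=> u; have iu : bundle_img i u.
    by near: u; exact: open_near (open_bundle_img hM i) p0.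
  exact: chart_invP.
exact: (@pushforward_chart _ _ _ TsM M hN hM _ _ _ w X i i erefl ai xi nP d
  (etrans Xi (esym e1))).
Unshelve. all: by end_near. Qed.

(** A 1-form through a that is parallel along X has its derivative along X
    prescribed by the connection. *)
Lemma horizontal_coord (w : tangent a) : horizontal D w ->
  w i = row_mx (lsubmx (w i)) (transport G u0 (lsubmx (w i)) al).
Proof.
move=> [X [s [sX ss sa Ds [_ /(_ i i xi ai) H]]]].
have [d e] := section_rep_diff (X x) ss xi.
have {}H := etrans H e.
have sal : cocoord i (s x) = al.
  by have := congr1 (bundle_map i) sa => /eq_row_mx[].
have /(dual_conn0 sX ss Na) {}Ds := Ds.
have {}H := etrans H (congr1 (row_mx _) Ds).
by rewrite H row_mxKl /u0 -sal.
Qed.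

Lemma exists_form (s : 'rV[R]_n -> 'rV[R]_n) : smooth_on (chart_img i) s ->
  exists2 t : one_form M, smooth_form t &
    {near u0, s =1 (fun u => cocoord i (t (chart_inv i u)))}.
Proof.
move=> sms; have [phi [N' [hphi N'x]]] := cutoff_exists hM xi.
exists (fun y => phi y *: coord_covec y i (s (chart_map i y))).
  exact: (extend_form hM hphi sms).
apply: filterS (near_chart hM (cutoff_open hphi) xi N'x) => u [iu Nu].
rewrite (cutoff1 hphi Nu) scale1r cocoord_covec ?chart_invK//.
exact: chart_invP.
Qed.

(** Existence is the substantial part: a 1-form whose components near the foot
    are alpha + Gamma(u - u0, alpha) is parallel at the foot in every
    direction. *)
Lemma hliftE (X : tangent (bundle_proj a)) :
  hlift D X i = row_mx (X i) (transport G u0 (X i) al).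
Proof.
pose w := coord_vec a (i : chart_index TsM)
  (row_mx (X i) (transport G u0 (X i) al)).
have wi : w i = row_mx (X i) (transport G u0 (X i) al) by exact: coord_vecE.
suff -> : hlift D X = w by [].
apply: the_unique => [|w' [hw' /pushforward_projE pw']]; last first.
  by apply: (tangent_ext ai); rewrite (horizontal_coord hw') -pw' wi.
split; last by apply/pushforward_projE; rewrite wi row_mxKl.
have [X' [sX' X'x]] := exists_vf X xi.
have ll : linear (fun v => transport G u0 v al) by exact: transport_linear.
pose lM := GRing.isLinear.Build _ _ _ _ _ ll.
pose L : {linear 'rV[R]_n -> 'rV[R]_n} :=
  HB.pack (fun v => transport G u0 v al) lM.
have cL : continuous L by exact: linear_rV_continuous.
(* The affine map with value al at u0 and linear part Gamma(., al). *)
pose h (u : 'rV[R]_n) := L u + (al - L u0).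
have sh : smooth_on (chart_img i) h.
  move=> k; have oi := open_chart_img hM i.
  by apply: (CkD oi); [exact: Ck_lin|exact: Ck_cst].
have [s ss sE] := exists_form sh.
have sx : s x = covector a.
  apply: (cocoord_ext hM xi).
  have := nbhs_singleton sE; rewrite /u0 chart_mapK// => <-.
  by rewrite /h addrCA subrr addr0.
have dh : differentiable h u0.
  by apply: (sh 1%N).1; exact: chart_imgP.
have [d e] := near_eq_diff sE dh.
have dsE (v : tangent x) :
    'd (fun u => cocoord i (s (chart_inv i u))) u0 (v i) = transport G u0
      (v i) al.
  apply: etrans (congr1 (@^~ (v i)) e) _.
  have dL : differentiable L u0 by exact: linear_differentiable.
  have dc : differentiable (cst (al - L u0) : 'rV[R]_n -> 'rV[R]_n) u0.
    exact: differentiable_cst.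
  apply: etrans (congr1 (@^~ (v i)) (diffD dL dc)) _.
  rewrite -[RHS]addr0; congr (_ + _).
    exact: (congr1 (@^~ (v i)) (diff_lin u0 cL)).
  exact: (congr1 (@^~ (v i)) (diff_cst _ _)).
have sa : section_of s x = a by rewrite /section_of sx; exact: covector_eta.
exists X', s; split; [exact: sX'|exact: ss|exact: sa| |].
  by apply/(dual_conn0 sX' ss Na); rewrite sx; exact: dsE.
have [dF eF] := section_rep_diff (X' x) ss xi.
have nP : \forall u \near chart_map i x,
    chart_dom (i : chart_index TsM) (section_of s (chart_inv i u)).
  near=> u; have iu : chart_img i u.
    by near: u; exact: open_near (open_chart_img hM i) (chart_imgP xi).
  exact: chart_invP.
apply: (@pushforward_chart _ _ _ M TsM hM hN (section_of s) x a (X' x) w i i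
  sa xi ai nP dF).
apply: etrans wi _; rewrite -X'x; apply: etrans _ (esym eF).
exact: (congr1 (row_mx _) (esym (dsE _))).
Unshelve. all: by end_near. Qed.

(** In another chart the line through a in the direction b is the image under
    the transition map of a straight line, so its velocity is a directional
    derivative of that map, by the very definition of both limits. *)
Lemma vliftE (b : cotangent (bundle_proj a)) :
  vlift b i = row_mx 0 (cocoord i b).
Proof.
pose q : 'rV[R]_(n + n) := row_mx 0 (cocoord i b).
pose w := coord_vec a (i : chart_index TsM) q.
have wi : w i = q by exact: coord_vecE.
have lineE (t : R) : bundle_map i (Covector (covector a + t *: b)) =
    t *: q + bundle_map i a.
  rewrite /bundle_map /q /= scale_row_mx scaler0 add_row_mx add0r.
  by rewrite cocoordD cocoordZ addrC.
have wP j : chart_dom (j : chart_index TsM) a -> w j =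
    derive1 (fun t : R => chart_map j (Covector (covector a + t *: b) : TsM)) 0.
  move=> aj; rewrite (tangentP w ai aj) wi.
  have dT := transition_differentiable hN ai aj.
  apply: etrans (esym (deriveE q dT)) _; rewrite /derive /derive1.
  apply: (congr1 (fun F : R -> 'rV[R]_(n + n) => lim (F @ 0^'))).
  apply/funext => h.
  congr (_ *: (_ - _)).
    by rewrite /transition /= addr0 -lineE bundle_invK.
  by rewrite /transition /= scale0r addr0 bundle_invK// covector_eta.
suff -> : vlift b = w by [].
apply: the_unique => [//|w' w'P]; apply: (tangent_ext ai).
by rewrite wP//; exact: w'P.
Qed.

Lemma PhiE (w : tangent (bundle_proj a) * cotangent (bundle_proj a)) :
  Phi D w i = row_mx (w.1 i) (transport G u0 (w.1 i) al + cocoord i w.2).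
Proof. by rewrite /Phi tangentD hliftE vliftE add_row_mx addr0. Qed.

Lemma Phi_invE (v : tangent a) :
  Phi_inv D v = (coord_vec (bundle_proj a) i (lsubmx (v i)),
    coord_covec (bundle_proj a) i
      (rsubmx (v i) - transport G u0 (lsubmx (v i)) al)).
Proof.
apply: the_unique => [|[X b] /= Xb].
  apply: (tangent_ext ai); rewrite PhiE /= coord_vecE// cocoord_covec//.
  by rewrite addrC subrK hsubmxK.
have := PhiE (X, b); rewrite Xb /= => ->.
by rewrite row_mxKl row_mxKr [_ + cocoord i b]addrC addrK coord_vecK//
  coord_covecK.
Qed.

Lemma Phi_invK (v : tangent a) : Phi D (Phi_inv D v) = v.
Proof.
apply: (tangent_ext ai); rewrite PhiE Phi_invE /= coord_vecE// cocoord_covec//.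
by rewrite addrC subrK hsubmxK.
Qed.

Lemma PhiK (w : tangent (bundle_proj a) * cotangent (bundle_proj a)) :
  Phi_inv D (Phi D w) = w.
Proof.
case: w => X b; rewrite Phi_invE PhiE /= row_mxKl row_mxKr
  [_ + cocoord i b]addrC addrK.
by rewrite coord_vecK// coord_covecK.
Qed.

Lemma Phi_linear_chart : linear (@Phi R n M D a).
Proof.
move=> c w z; apply: (tangent_ext ai).
transitivity (c *: Phi D w i + Phi D z i); last by [].
have e1 : (c *: w + z).1 i = c *: w.1 i + z.1 i by [].
have e2 : cocoord i (c *: w + z).2 = c *: cocoord i w.2 + cocoord i z.2.
  by rewrite -cocoordZ -cocoordD.
apply: etrans (PhiE _) _.
apply: etrans _ (esym (congr2 (fun p q => c *: p + q) (PhiE w) (PhiE z))).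
rewrite e1.
rewrite e2.
have e3 : transport G u0 (c *: w.1 i + z.1 i) al =
    c *: transport G u0 (w.1 i) al + transport G u0 (z.1 i) al.
  exact: transport_linear.
by rewrite e3 scale_row_mx add_row_mx scalerDr addrACA.
Qed.

End at_covector.
End in_chart.
End parallel.

(** * Linear algebra in one fibre *)

Section pointwise.
Context (R : realType) (n : nat) (M : charted R n).
Hypothesis hM : smooth_manifold M.
Implicit Types (i : chart_index M) (x : M).

Section endomorphism.
Variable J : endo_field M.
Arguments J : clear implicits.
Hypothesis lJ : forall x, linear (J x).
Arguments lJ : clear implicits.

Lemma pullbackE x (b : cotangent x) X : pullback J b X = b (J x X).
Proof.
have [|c cE] := @exists_cotangent _ _ _ x (fun X => b (J x X)).
  by move=> t Y Z; rewrite lJ; exact: cotangentP.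
rewrite /pullback (the_unique (x := c)) ?cE// => c' c'E.
by apply: cotangent_ext => Y; rewrite c'E cE.
Qed.

Lemma pullback_linear x (t : R) (b c : cotangent x) :
  pullback J (t *: b + c) = t *: pullback J b + pullback J c.
Proof.
by apply: cotangent_ext => X;
  rewrite pullbackE !cotangentD !cotangentZ !pullbackE.
Qed.

Lemma J_hat_linear x (t : R) (w z : tangent x * cotangent x) :
  J_hat J (t *: w + z) = t *: J_hat J w + J_hat J z.
Proof. exact: (congr2 pair (lJ x t w.1 z.1) (pullback_linear t w.2 z.2)). Qed.

(** J* satisfies the same polynomial equation as J. *)
Lemma J_hat_metallic x p q (w : tangent x * cotangent x) :
  (forall X : tangent x, J x (J x X) = p *: J x X + q *: X) ->
  J_hat J (J_hat J w) = p *: J_hat J w + q *: w.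
Proof.
move=> JJ.
have JJ2 : pullback J (pullback J w.2) = p *: pullback J w.2 + q *: w.2.
  apply: cotangent_ext => X;
    rewrite !pullbackE JJ cotangentD !cotangentZ pullbackE.
  by rewrite linearD !linearZ.
exact: (congr2 pair (JJ w.1) JJ2).
Qed.

Lemma cocoord_pullback i x (b : cotangent x) (m : 'I_n) : chart_dom i x ->
  cocoord i (pullback J b) 0 m =
  \sum_l cocoord i b 0 l * J x (frame i m x) i 0 l.
Proof. by move=> xi; rewrite mxE pullbackE -cotangentE. Qed.

Lemma endo_coord i x (X : tangent x) : chart_dom i x ->
  J x X i = \sum_k X i 0 k *: J x (frame i k x) i.
Proof.
move=> xi; pose lM := GRing.isLinear.Build _ _ _ _ _ (lJ x).
pose L : {linear tangent x -> tangent x} := HB.pack (J x) lM.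
rewrite -[J x X]/(L X) {1}(coord_vec_expand hM X xi) linear_sum tangent_sum.
by apply: eq_bigr => k _; rewrite linearZ.
Qed.

End endomorphism.

Section metric.
Variable g : form_field M.
Arguments g : clear implicits.
Hypothesis hg : riemannian_metric g.

Definition gram i x : 'M[R]_n := \matrix_(k, l) g x (frame i k x) (frame i l x).

Let gC x (X Y : tangent x) : g x X Y = g x Y X.
Proof. by case: hg => _ + _ _; exact. Qed.

Lemma metric_suml x (I : Type) (r : seq I) (c : I -> R) (X : I -> tangent x) Y :
  g x (\sum_(k <- r) c k *: X k) Y = \sum_(k <- r) c k * g x (X k) Y.
Proof.
have [lg _ _ _] := hg.
pose lM := GRing.isLinear.Build _ _ _ _ _ (lg x Y).
pose L : {linear tangent x -> R^o} := HB.pack (fun X => g x X Y) lM.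
rewrite -[LHS]/(L _) linear_sum; apply: eq_bigr => k _.
by rewrite linearZ.
Qed.

Lemma metric0l x (Y : tangent x) : g x 0 Y = 0.
Proof.
have := metric_suml (x := x) ([::] : seq unit) (fun=> 0) (fun=> 0) Y.
by rewrite !big_nil.
Qed.

Lemma metric_coord i x (X Y : tangent x) : chart_dom i x ->
  g x X Y = \sum_k (X i *m gram i x) 0 k * Y i 0 k.
Proof.
move=> xi; rewrite {1}(coord_vec_expand hM Y xi) gC metric_suml.
apply: eq_bigr => k _; rewrite mulrC gC; congr (_ * _).
rewrite {1}(coord_vec_expand hM X xi) metric_suml mxE.
by apply: eq_bigr => l _; rewrite mxE.
Qed.

(** A vector in the kernel of the Gram matrix has length zero. *)
Lemma gram_unit i x : chart_dom i x -> gram i x \in unitmx.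
Proof.
move=> xi; rewrite -row_free_unit; apply: inj_row_free => v vg.
have [_ _ gpos _] := hg; pose X := coord_vec x i v.
have Xv : X i = v by exact: coord_vecE.
have [X0|/eqP X0] := pselect (X = 0); first by rewrite -Xv X0 tangent0.
have := gpos x X X0; rewrite (metric_coord _ _ xi) Xv vg big1 ?ltxx//.
by move=> k _; rewrite mxE mul0r.
Qed.

Lemma flatE x (X Y : tangent x) : Defs.flat g X Y = g x X Y.
Proof.
have [lg _ _ _] := hg.
have [|c cE] := @exists_cotangent _ _ _ x (fun Y => g x X Y).
  move=> t Y' Z; have E := lg x X t Y' Z.
  by rewrite gC [g x X Y']gC [g x X Z]gC; exact: E.
rewrite /flat (the_unique (x := c)) ?cE// => c' c'E.
by apply: cotangent_ext => Z; rewrite c'E cE.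
Qed.

(** Raising an index by the inverse of the Gram matrix. *)
Lemma sharp_coord i x (b : cotangent x) : chart_dom i x ->
  sharp g b = coord_vec x i (cocoord i b *m invmx (gram i x)).
Proof.
move=> xi; have ug := gram_unit xi.
apply: the_unique => [|X Xb].
  apply: cotangent_ext => Y; rewrite flatE (metric_coord _ _ xi) coord_vecE//.
  by rewrite mulmxKV// -cotangentE.
apply: (tangent_ext xi); rewrite coord_vecE//.
have -> : cocoord i b = X i *m gram i x.
  apply/rowP => k; rewrite -Xb mxE flatE (metric_coord _ _ xi) coord_vecE//.
  exact: dot_delta.
by rewrite mulmxK.
Qed.

Lemma sharpE x (b : cotangent x) Y : g x (sharp g b) Y = b Y.
Proof.
have [i xi] := chart_cover hM x.
rewrite (metric_coord _ _ xi) (sharp_coord b xi) coord_vecE// mulmxKV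
  ?gram_unit//.
by rewrite -cotangentE.
Qed.

Lemma sharp_linear x (t : R) (b c : cotangent x) :
  sharp g (t *: b + c) = t *: sharp g b + sharp g c.
Proof.
have [i xi] := chart_cover hM x; rewrite !(sharp_coord _ xi).
by rewrite -coord_vec_linear// cocoordD cocoordZ mulmxDl scalemxAl.
Qed.

Lemma sharp_eq0 x (b : cotangent x) : sharp g b = 0 -> b = 0.
Proof.
move=> b0; apply: cotangent_ext => Y; by rewrite -sharpE b0 metric0l.
Qed.

Lemma sharp_pairing i x (b c : cotangent x) : chart_dom i x ->
  g x (sharp g b) (sharp g c) =
  \sum_k cocoord i c 0 k * (cocoord i b *m invmx (gram i x)) 0 k.
Proof.
move=> xi; rewrite gC sharpE (cotangentE hM _ _ xi).
by apply: eq_bigr => k _; rewrite (sharp_coord b xi) coord_vecE.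
Qed.

Lemma g_hat_linear x (t : R) (w z y : tangent x * cotangent x) :
  g_hat g (t *: w + z) y = t * g_hat g w y + g_hat g z y.
Proof.
have [lg _ _ _] := hg; rewrite /g_hat.
have e1 : g x (t *: w + z).1 y.1 = t * g x w.1 y.1 + g x z.1 y.1 by exact: lg.
have e2 : g x (sharp g (t *: w + z).2) (sharp g y.2) =
    t * g x (sharp g w.2) (sharp g y.2) + g x (sharp g z.2) (sharp g y.2).
  apply: etrans (congr1 (fun s => g x s (sharp g y.2)) (sharp_linear t w.2 z.2))
    _.
  exact: lg.
by rewrite e1 e2; ring.
Qed.

Lemma g_hatC x (w z : tangent x * cotangent x) : g_hat g w z = g_hat g z w.
Proof. by rewrite /g_hat gC [g x (sharp _ _) _]gC. Qed.

Lemma g_hat_gt0 x (w : tangent x * cotangent x) : w != 0 -> 0 < g_hat g w w.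
Proof.
have [_ _ gpos _] := hg.
have g0 (X : tangent x) : 0 <= g x X X.
  by have [->|X0] := eqVneq X 0; [rewrite metric0l|exact/ltW/gpos].
case: w => X b; rewrite /g_hat /= => w0.
have [X0|X0] := eqVneq X 0; last by rewrite ltr_wpDr// gpos.
rewrite ltr_wpDl// gpos//; apply: contra w0 => /eqP/sharp_eq0 ->.
by rewrite X0.
Qed.

(** On covectors: sharp intertwines J* with J, as J is self-adjoint. *)
Lemma g_hat_adjoint (J : endo_field M) x (w z : tangent x * cotangent x) :
  (forall x, linear (J x)) ->
  (forall x (X Y : tangent x), g x (J x X) Y = g x X (J x Y)) ->
  g_hat g (J_hat J w) z = g_hat g w (J_hat J z).
Proof.
move=> lJ sJ; rewrite /g_hat /= sJ; congr (_ + _).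
rewrite sharpE pullbackE// -sharpE -sJ gC sharpE.
by rewrite [RHS]gC sharpE pullbackE.
Qed.

End metric.
End pointwise.

(** * Phi as an isomorphism of fibres *)

Section bundle_pointwise.
Context (R : realType) (n : nat) (M : charted R n).
Hypothesis hM : smooth_manifold M.
Variable D : vector_field M -> vector_field M -> vector_field M.
Hypothesis hD : linear_connection D.
Local Notation TsM := (cotangent_manifold M).
Variable a : TsM.

(** The chart is chosen at the foot of a, so the fibrewise statements below do
    not mention one. *)
Lemma christoffel_at :
  exists i N G, @christoffel R n M D i N G /\ N (bundle_proj a).
Proof.
have [i xi] := chart_cover hM (bundle_proj a).
by have [N [G H]] := christoffel_exists hM hD xi; exists i, N, G.
Qed.

Lemma Phi_inv_cancel w : Phi_inv D (@Phi R n M D a w) = w.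
Proof. by have [i [N [G [hG Na]]]] := christoffel_at;
  exact: (PhiK hM hG Na w). Qed.

Lemma Phi_cancel v : @Phi R n M D a (Phi_inv D v) = v.
Proof. by have [i [N [G [hG Na]]]] := christoffel_at;
  exact: (Phi_invK hM hG Na v). Qed.

Lemma Phi_linear : linear (@Phi R n M D a).
Proof.
by have [i [N [G [hG Na]]]] := christoffel_at;
  exact: (Phi_linear_chart hM hG Na).
Qed.

Lemma Phi0 : @Phi R n M D a 0 = 0.
Proof.
pose lM := GRing.isLinear.Build _ _ _ _ _ Phi_linear.
pose L : {linear _ -> _} := HB.pack (@Phi R n M D a) lM.
exact: (linear0 L).
Qed.

Lemma PhiZ (t : R) w : @Phi R n M D a (t *: w) = t *: Phi D w.
Proof. by have := Phi_linear t w 0; rewrite Phi0 !addr0. Qed.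

Lemma Phi_inv_linear (t : R) (v w : tangent a) :
  Phi_inv D (t *: v + w) = t *: Phi_inv D v + Phi_inv D w.
Proof.
rewrite -[RHS]Phi_inv_cancel; congr (Phi_inv D _).
by rewrite Phi_linear !Phi_cancel.
Qed.

End bundle_pointwise.

(** * Smoothness of the transported tensors *)

Section smoothness.
Context (R : realType) (n : nat) (M : charted R n).
Hypothesis hM : smooth_manifold M.
Variable D : vector_field M -> vector_field M -> vector_field M.
Hypothesis hD : linear_connection D.
Local Notation TsM := (cotangent_manifold M).
Let hN : smooth_manifold TsM := bundle_manifold hM.

Section in_chart.
Variables (i : chart_index M) (N : set M).
Variable G : 'I_n -> 'I_n -> 'rV[R]_n -> 'rV[R]_n.
Hypothesis hG : christoffel D i N G.

Lemma Ck_transport (V : normedModType R) k (U : set V) (t X b : V -> 'rV[R]_n) :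
  open U -> (forall u, U u -> chart_img i (t u)) ->
  Ck_on k U t -> Ck_on k U X -> Ck_on k U b ->
  Ck_on k U (fun u => transport G (t u) (X u) (b u)).
Proof.
move=> oU tU kt kX kb; apply: Ck_row => // m.
apply: (@eq_Ck _ _ _ _ _ (fun u => \sum_j X u 0 j *
    (\sum_l b u 0 l * G j m (t u) 0 l) : R^o)) => //.
  by move=> u _; rewrite mxE.
apply: Ck_sum => // j; apply: (CkM oU (Ck_coord j oU kX)).
apply: (Ck_dot oU kb).
exact: (Ck_comp oU (open_chart_img hM i) tU kt (chr_smooth hG j m k)).
Qed.

Definition christoffel_dom : set 'rV[R]_(n + n) :=
  lsubmx @^-1` (chart_img i `&` chart_inv i @^-1` N).

Lemma open_christoffel_dom : open christoffel_dom.
Proof. exact: open_lsubmx_preim (open_chart_preim hM i N (chr_open hG)). Qed.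

Lemma cocoord_bundle_inv u : bundle_img i u ->
  cocoord i (covector (bundle_inv i u)) = rsubmx u.
Proof. by move=> iu; rewrite cocoord_covec//; exact: chart_invP. Qed.

(** The covector part of the inverse of Phi on the vector with coordinates e. *)
Definition vert_part (e u : 'rV[R]_(n + n)) : 'rV[R]_n :=
  rsubmx e - transport G (lsubmx u) (lsubmx e) (rsubmx u).

Lemma Phi_inv_coord u e : christoffel_dom u ->
  Phi_inv D (coord_vec (bundle_inv i u : TsM) (i : chart_index TsM) e) =
  (coord_vec (chart_inv i (lsubmx u)) i (lsubmx e),
   coord_covec (chart_inv i (lsubmx u)) i (vert_part e u)).
Proof.
move=> [iu Nu].
have ai : chart_dom (i : chart_index TsM) (bundle_inv i u : TsM).
  exact: bundle_dom_inv.
apply: etrans (Phi_invE hM hG (a := bundle_inv i u) Nu _) _.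
by rewrite coord_vecE// cocoord_bundle_inv// chart_invK.
Qed.

Lemma Ck_vert_part k (e : 'rV[R]_(n + n)) :
  Ck_on k christoffel_dom (fun u => vert_part e u).
Proof.
have oU := open_christoffel_dom.
apply: CkD => //; first exact: Ck_cst.
apply: CkN => //; apply: Ck_transport => //; first by move=> u [].
- exact: Ck_lsubmx.
- exact: Ck_cst.
- exact: Ck_rsubmx.
Qed.

Section endomorphism.
Variable J : endo_field M.
Hypothesis tJ : tensor11 J.

Let lJ : forall x, linear (@J x). Proof. by case: tJ. Qed.

Let Jcol (k : 'I_n) (v : 'rV[R]_n) : 'rV[R]_n :=
  @J (chart_inv i v) (frame i k (chart_inv i v)) i.

(* The two halves of the fibrewise endomorphism in coordinates: J on the
   tangent part and its transpose on the covector part. *)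
Let Jhor (e u : 'rV[R]_(n + n)) : 'rV[R]_n :=
  \sum_k lsubmx e 0 k *: Jcol k (lsubmx u).

Let Jver (e u : 'rV[R]_(n + n)) : 'rV[R]_n :=
  \row_m \sum_l vert_part e u 0 l * Jcol m (lsubmx u) 0 l.

Lemma J_tilde_coord u e : christoffel_dom u ->
  J_tilde D J (coord_vec (bundle_inv i u : TsM) (i : chart_index TsM) e) i =
  row_mx (Jhor e u)
    (transport G (lsubmx u) (Jhor e u) (rsubmx u) + Jver e u).
Proof.
move=> iNu; have [iu Nu] := iNu; have ci := chart_invP hM iu.
rewrite /J_tilde Phi_inv_coord//.
apply: etrans (PhiE hM hG (a := bundle_inv i u) Nu _) _.
rewrite cocoord_bundle_inv//.
have -> : chart_map i (bundle_proj (bundle_inv i u : TsM)) = lsubmx u.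
  exact: chart_invK.
have -> : (J_hat J (coord_vec (chart_inv i (lsubmx u)) i (lsubmx e),
    coord_covec (chart_inv i (lsubmx u)) i (vert_part e u))).1 i = Jhor e u.
  by rewrite /= (endo_coord hM lJ _ ci) coord_vecE.
congr (row_mx _ (_ + _)); apply/rowP => m.
by rewrite [RHS]mxE (cocoord_pullback hM lJ _ _ ci) cocoord_covec.
Qed.

Lemma Ck_J_tilde k e : Ck_on k christoffel_dom (fun u =>
  J_tilde D J (coord_vec (bundle_inv i u : TsM) (i : chart_index TsM) e) i).
Proof.
have oU := open_christoffel_dom; have oi := open_chart_img hM i.
have lU u : christoffel_dom u -> chart_img i (lsubmx u) by move=> [].
have kl := Ck_lsubmx k oU.
have kcol m : Ck_on k christoffel_dom (fun u => Jcol m (lsubmx u)).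
  by apply: (Ck_comp oU oi lU kl); case: tJ => _; exact.
have khor : Ck_on k christoffel_dom (Jhor e).
  by apply: Ck_sum => // m; apply: CkZ => //; exact: Ck_cst.
have kver : Ck_on k christoffel_dom (Jver e).
  apply: Ck_row => // m; apply: (@eq_Ck _ _ _ _ _ (fun u => \sum_l
    vert_part e u 0 l * Jcol m (lsubmx u) 0 l : R^o)) => //.
    by move=> u _; rewrite mxE.
  by apply: Ck_dot => //; exact: Ck_vert_part.
have H : Ck_on k christoffel_dom (fun u => row_mx (Jhor e u)
    (transport G (lsubmx u) (Jhor e u) (rsubmx u) + Jver e u)).
  apply: Ck_row_mx => //; apply: CkD => //.
  by apply: Ck_transport => //; exact: Ck_rsubmx.
by apply: eq_Ck H => // u /[1!inE] iNu; rewrite J_tilde_coord.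
Qed.

End endomorphism.

Section metric.
Variable g : form_field M.
Hypothesis hg : riemannian_metric g.

Lemma g_tilde_coord u e e' : christoffel_dom u ->
  g_tilde D g (coord_vec (bundle_inv i u : TsM) (i : chart_index TsM) e)
    (coord_vec (bundle_inv i u : TsM) (i : chart_index TsM) e') =
  \sum_k (lsubmx e *m gram g i (chart_inv i (lsubmx u))) 0 k * lsubmx e' 0 k +
  \sum_k vert_part e' u 0 k *
    (vert_part e u *m invmx (gram g i (chart_inv i (lsubmx u)))) 0 k.
Proof.
move=> iNu; have [iu Nu] := iNu; have ci := chart_invP hM iu.
rewrite /g_tilde /g_hat !Phi_inv_coord//= (sharp_pairing hM hg _ _ ci).
by rewrite (metric_coord hM hg _ _ ci) !coord_vecE// !cocoord_covec.
Qed.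

Lemma Ck_g_tilde k e e' : Ck_on k christoffel_dom (fun u =>
  g_tilde D g (coord_vec (bundle_inv i u : TsM) (i : chart_index TsM) e)
    (coord_vec (bundle_inv i u : TsM) (i : chart_index TsM) e') : R^o).
Proof.
have oU := open_christoffel_dom; have oi := open_chart_img hM i.
have lU u : christoffel_dom u -> chart_img i (lsubmx u) by move=> [].
have kl := Ck_lsubmx k oU.
have kgram r s : Ck_on k christoffel_dom
    (fun u => gram g i (chart_inv i (lsubmx u)) r s : R^o).
  have kg : Ck_on k (chart_img i) (fun v => gram g i (chart_inv i v) r s : R^o).
    have [_ _ _ sg] := hg.
    by apply: eq_Ck (sg i r s k) => // v _; rewrite mxE.
  exact: (Ck_comp_scalar oU oi lU kl kg).
have H : Ck_on k christoffel_dom (fun u =>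
  \sum_k (lsubmx e *m gram g i (chart_inv i (lsubmx u))) 0 k * lsubmx e' 0 k +
  \sum_k vert_part e' u 0 k *
    (vert_part e u *m invmx (gram g i (chart_inv i (lsubmx u)))) 0 k : R^o).
  apply: CkD => //; apply: Ck_dot => //.
  - by apply: Ck_mulmx => //; exact: Ck_cst.
  - exact: Ck_cst.
  - exact: Ck_vert_part.
  apply: Ck_mulmx => //; first exact: Ck_vert_part.
  apply: Ck_invmx => // u [iu _].
  by apply: gram_unit => //; exact: chart_invP.
by apply: eq_Ck H => // u /[1!inE] iNu; rewrite g_tilde_coord.
Qed.

End metric.
End in_chart.

(** Smoothness is local, and every point of a chart lies in the domain of
    some system of Christoffel symbols. *)
Lemma smooth_near_christoffel (W : normedModType R) i
    (F : 'rV[R]_(n + n) -> W) :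
  (forall N G, christoffel D i N G ->
    forall k, Ck_on k (christoffel_dom i N) F) ->
  smooth_on (chart_img (i : chart_index TsM)) F.
Proof.
move=> H k; rewrite bundle_imgE//; apply: Ck_local => u iu.
have [N [G [hG Nu]]] := christoffel_exists hM hD (chart_invP hM iu).
by exists (christoffel_dom i N); [split|exact: H hG k].
Qed.

End smoothness.

Theorem proposition3p3 (R : realType) (n : nat) (M : charted R n) (p q : R)
    (J : endo_field M) (g : form_field M)
    (D : vector_field M -> vector_field M -> vector_field M)
    (hM : metallic_riemannian p q J g) (hD : linear_connection D) :
  metallic_riemannian p q (J_tilde D J) (g_tilde D g).
Proof.
have [mM tJ JJ hg sJ] := hM; have [lJ _] := tJ; have [_ gC _ _] := hg.
split.
- exact: bundle_manifold.
- split=> [a c v w|i k].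
    rewrite /J_tilde (Phi_inv_linear mM hD) (J_hat_linear lJ).
    exact: (Phi_linear mM hD).
  apply: (smooth_near_christoffel mM hD) => N G hG m.
  exact: (Ck_J_tilde mM hG tJ).
- move=> a v; rewrite /J_tilde (Phi_inv_cancel mM hD).
  rewrite (J_hat_metallic lJ _ (JJ _)) (Phi_linear mM hD); congr (_ + _).
  by rewrite (PhiZ mM hD) (Phi_cancel mM hD).
- split.
  + move=> a w c v v'; rewrite /g_tilde (Phi_inv_linear mM hD).
    exact: (g_hat_linear mM hg).
  + by move=> a v w; rewrite /g_tilde (g_hatC hg).
  + move=> a v v0; apply: (g_hat_gt0 mM hg); apply: contra v0 => /eqP e.
    by rewrite -(Phi_cancel mM hD v) e (Phi0 mM hD).
  + move=> i k l; apply: (smooth_near_christoffel mM hD) => N G hG m.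
    exact: (Ck_g_tilde mM hG hg).
- move=> a v w; rewrite /g_tilde /J_tilde.
  have e1 := Phi_inv_cancel mM hD (J_hat J (Phi_inv D v)).
  have e2 := Phi_inv_cancel mM hD (J_hat J (Phi_inv D w)).
  apply: etrans (congr1 (fun z => g_hat g z (Phi_inv D w)) e1) _.
  apply: etrans _ (esym (congr1 (g_hat g (Phi_inv D v)) e2)).
  exact: (g_hat_adjoint mM hg).
Qed.
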